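(* Let $(L/K,v)$ be a finite valued field extension (of arbitrary rank) and let $p$ be the (positive) characteristic of the residue field $Kv$. Assume that either (Artin–Schreier case) $L=K(\eta)$ is an Artin–Schreier extension of $K$, the minimal polynomial of $\eta$ over $K$ is $g=x^p-x-a$ (with $a\in K$), and $d(L/K,v)=p$; or (Kummer case) $K$ contains a primitive $p$-th root of unity, $L=K(\eta)$ is a Kummer extension of $K$, the minimal polynomial of $\eta$ over $K$ is $g=x^p-a$ (with $a\in K$), $v(a)=0$ and $d(L/K,v)=p$. Consider the valuation $\nu$ on $K[x]$ with support $gK[x]$ induced by $v$. Then, with $\delta_g$ and $B(g)$ taken with respect to the plateau $\Psi_1$ and its limit key polynomial $g$, we have $\delta_g<\infty^-$ and $$B(g)=\emptyset\Longleftrightarrow (L/K,v)\text{ is dependent.}$$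
   Context: Conventions: $(L/K,v)$ means that $v$ is a valuation on $L$ (and, by restriction, on $K$). $vL$ is the value group, $\Gamma$ is the divisible closure of $vL$. The defect $d(L/K,v)$ is defined as usual by $[L^h:K^h]=d(L/K,v)\,(vL:vK)\,[Lv:Kv]$, with $L^h,K^h$ henselizations; in both cases above $d(L/K,v)=p=[L:K]$ forces $vL=vK$ and $Lv=Kv$. The valuation $\nu$: $\nu(f):=v(f(\eta))$ for $f\in K[x]$. Key polynomials: fix an algebraic closure $\overline K$ of $K$ and an extension $\overline\nu$ of $\nu$ to $\overline K[x]$. For $f\in K[x]$ set $\epsilon(f):=\max\{\overline\nu(x-a)\mid a\in\overline K\text{ a root of }f\}$ (with $\epsilon(f)=-\infty$ for nonzero constants). A monic $Q\in K[x]$ of positive degree is a key polynomial for $\nu$ if $\deg(f)<\deg(Q)$ implies $\epsilon(f)<\epsilon(Q)$ for all nonzero $f\in K[x]$. $\Psi_n$ is the set of all key polynomials for $\nu$ of degree $n$ (in particular $\Psi_1=\{x-b\mid b\in K\}$). A key polynomial for $\Psi_n$ is a key polynomial for $\nu$ of smallest degree larger than $n$. If $\Psi_n$ is nonempty and $\nu(\Psi_n)$ has no maximum, $\Psi_n$ is called a plateau for $\nu$ and key polynomials for $\Psi_n$ are called limit key polynomials for $\Psi_n$. For a key polynomial $Q$ and $f\in K[x]$, write the $Q$-expansion $f=\sum_i a_{Qi}(f)Q^i$ with $\deg a_{Qi}(f)<\deg Q$, and $\nu_Q(f)=\min_{i:\,a_{Qi}(f)\ne0}\nu(a_{Qi}(f)Q^i)$.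 Cuts: a cut on $\Gamma$ is given by its lower cut set; cuts are ordered by inclusion of lower cut sets; the lower cut set of a cut $\delta$ is denoted $\delta^L$. For $S\subseteq\Gamma\cup\{\infty\}$, $\overline S$ is the cut with lower cut set $\{\gamma\in\Gamma\mid\exists s\in S,\ \gamma\le s\}$ and $S^-$ is the cut with lower cut set $\{\gamma\in\Gamma\mid\gamma<s\text{ for every }s\in S\}$. So $\infty^-=\{\infty\}^-$ is the cut with lower cut set $\Gamma$. For $\alpha\in\Gamma$, $\alpha+S^-$ is the cut whose lower cut set is that of $S^-$ translated by $\alpha$. The cut $\delta_F$ and the set $B(F)$: for a plateau $\Psi_n$ and a limit key polynomial $F$ for $\Psi_n$, let $\delta_F=\overline{\{\nu_Q(F)\mid Q\in\Psi_n\}}$. There is $D\in\mathbb N$ such that for every $Q\in\Psi_n$ the $Q$-expansion of $F$ is of the form $F=a_{Q0}(F)+\ldots+a_{QD}(F)Q^D$ with $a_{QD}(F)\neq 0$. Then $B(F)$ is the set of $b\in\{1,\ldots,D-1\}$ such that $\nu(a_{Qb}(F)Q^b)\in\delta_F^L$ for every $Q\in\Psi_n$ with large enough value $\nu(Q)$ (i.e. there is $Q_0\in\Psi_n$ such that this holds for all $Q\in\Psi_n$ with $\nu(Q)\ge\nu(Q_0)$). Here this is applied with $n=1$, $F=g$, $D=p$. (In)dependence: the distance of $\eta$ to $K$ is the cut ${\rm dist}(\eta,K)=\overline{\{v(\eta-b)\mid b\in K\}}$. In the Artin–Schreier case, $(L/K,v)$ is independent if ${\rm dist}(\eta,K)=H^-$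 for some convex subgroup $H$ of $\Gamma$. In the Kummer case, $(L/K,v)$ is independent if ${\rm dist}(\eta,K)=\frac{v(p)}{p-1}+H^-$ for some convex subgroup $H$ of $\Gamma$. Otherwise it is dependent. *)

(* Defs.v *)
From HB Require Import structures.
From mathcomp Require Import all_boot all_order all_algebra all_field.
From mathcomp Require Import generic_quotient ring_quotient.
From mathcomp Require Import boolp classical_sets cardinality.

Set Implicit Arguments.
Unset Strict Implicit.
Unset Printing Implicit Defensive.

Import Order.TTheory GRing.Theory.

Local Open Scope ring_scope.
Local Open Scope quotient_scope.
Local Open Scope classical_set_scope.

(* The total order is a mixin field: a join of GRing.Zmodule and Order.Total
   would have to be inserted below Num.RealDomain. *)
HB.mixin Record POrderedZmodule_isOrdered G of Num.POrderedZmodule G := {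
  ozmod_total : total (<=%R : rel G);
  ozmod_leD2l : forall z x y : G, x <= y -> z + x <= z + y
}.

#[short(type="orderedZmodType")]
HB.structure Definition OrderedZmodule :=
  { G of Num.POrderedZmodule G & POrderedZmodule_isOrdered G }.

(* Values of valuations lie in G with +oo added; -oo only serves as the value
   of epsilon on constants. *)
Variant ext (G : Type) := Fin of G | PInf | NInf.

Arguments PInf {G}.
Arguments NInf {G}.

Section ExtOrder.
Variable G : orderedZmodType.
Implicit Types x y z : ext G.

Definition ext_code x : option G + unit :=
  match x with Fin g => inl (Some g) | PInf => inl None | NInf => inr tt end.

Definition ext_decode (c : option G + unit) : ext G :=
  match c with inl (Some g) => Fin g | inl None => PInf | inr _ => NInf end.

Lemma ext_codeK : cancel ext_code ext_decode.
Proof. by case. Qed.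

HB.instance Definition _ := Choice.copy (ext G) (can_type ext_codeK).

Definition ext_le x y : bool :=
  match x, y with
  | NInf, _ | _, PInf => true
  | Fin a, Fin b => a <= b
  | _, _ => false
  end.

Definition ext_lt x y := (y != x) && ext_le x y.

Lemma ext_le_refl : reflexive ext_le.
Proof. by case=> //= g; exact: lexx. Qed.

Lemma ext_le_anti : antisymmetric ext_le.
Proof. by case=> [a||] [b||] //= /le_anti ->. Qed.

Lemma ext_le_trans : transitive ext_le.
Proof. by case=> [a||] [b||] [c||] //=; exact: le_trans. Qed.

Lemma ext_le_total : total ext_le.
Proof. by case=> [a||] [b||] //=; exact: ozmod_total. Qed.

HB.instance Definition _ := Order.isPOrder.Build ring_display (ext G)
  (fun _ _ => erefl) ext_le_refl ext_le_anti ext_le_trans.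
HB.instance Definition _ :=
  Order.POrder_isTotal.Build ring_display (ext G) ext_le_total.

Definition ext_add x y : ext G :=
  match x, y with
  | NInf, _ | _, NInf => NInf
  | Fin a, Fin b => Fin (a + b)
  | _, _ => PInf
  end.

End ExtOrder.

(* The support of a valuation, the set where it takes the value PInf, need not
   be trivial; on a field it is {0}, since it cannot contain a unit. *)
Record valuation (R : comNzRingType) (G : orderedZmodType) := Valuation {
  vfun :> R -> ext G;
  val_gtNInf : forall x, NInf < vfun x;
  val0 : vfun 0 = PInf;
  val1 : vfun 1 = Fin 0;
  valM : forall x y, vfun (x * y) = ext_add (vfun x) (vfun y);
  valD : forall x y, Order.min (vfun x) (vfun y) <= vfun (x + y)
}.

Section Pullback.
Variables (R S : comNzRingType) (G : orderedZmodType).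
Variables (v : valuation S G) (phi : {rmorphism R -> S}).

Fact pullback_gtNInf x : NInf < v (phi x).
Proof. exact: val_gtNInf. Qed.
Fact pullback0 : v (phi 0) = PInf.
Proof. by rewrite rmorph0 val0. Qed.
Fact pullback1 : v (phi 1) = Fin 0.
Proof. by rewrite rmorph1 val1. Qed.
Fact pullbackM x y : v (phi (x * y)) = ext_add (v (phi x)) (v (phi y)).
Proof. by rewrite rmorphM valM. Qed.
Fact pullbackD x y : Order.min (v (phi x)) (v (phi y)) <= v (phi (x + y)).
Proof. by rewrite rmorphD valD. Qed.

Definition pullback : valuation R G :=
  @Valuation R G (fun x => v (phi x))
    pullback_gtNInf pullback0 pullback1 pullbackM pullbackD.

End Pullback.

Section ValueGroup.
Variable G : orderedZmodType.

Definition value_group (K : fieldType) (v : valuation K G) : set G :=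
  [set g | exists x, v x = Fin g].

Definition is_divisible_closure (S : set G) : Prop :=
  (forall (g : G) n, (0 < n)%N -> exists h, h *+ n = g) /\
  (forall g : G, exists2 n, (0 < n)%N & S (g *+ n)).

Definition group_index (A B : set G) (e : nat) : Prop :=
  ([set [set a + b | b in B] | a in A] #= `I_e)%card.

End ValueGroup.

Section ResidueField.
Variables (K : fieldType) (G : orderedZmodType) (v : valuation K G).

Lemma val_fieldNInf x : v x != NInf.
Proof. by have := val_gtNInf v x; rewrite lt_neqAle eq_sym => /andP[]. Qed.

Lemma val_field_neq0 x : x != 0 -> exists g, v x = Fin g.
Proof.
move=> x0; have := valM v x x^-1; rewrite divff // val1.
move: (val_fieldNInf x) (val_fieldNInf x^-1).
by case: (v x) => [g||] //; [exists g | case: (v x^-1)].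
Qed.

Lemma val_fieldV x (g : G) : v x = Fin g -> v x^-1 = Fin (- g).
Proof.
move=> vx; have x0 : x != 0.
  by apply: contra_eq_neq vx => ->; rewrite val0.
have [h vh] : exists h, v x^-1 = Fin h by apply: val_field_neq0; rewrite invr_eq0.
have := valM v x x^-1; rewrite divff // val1 vx vh => -[] /eqP.
by rewrite eq_sym addr_eq0 => /eqP ->; rewrite opprK.
Qed.

Lemma valN1 : v (-1) = Fin 0.
Proof.
have [g vg] : exists g, v (-1) = Fin g by apply: val_field_neq0; rewrite oppr_eq0 oner_eq0.
have := valM v (-1) (-1); rewrite mulrNN mulr1 val1 vg /= => -[] h; congr Fin.
have /orP[g0|g0] := ozmod_total 0 g.
  apply/eqP; rewrite eq_le g0 andbT.
  by have := ozmod_leD2l g _ _ g0; rewrite addr0 -h.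
apply/eqP; rewrite eq_le g0 /=.
by have := ozmod_leD2l g _ _ g0; rewrite addr0 -h.
Qed.

Lemma ext_add0 (x : ext G) : ext_add (Fin 0) x = x.
Proof. by case: x => //= g; rewrite add0r. Qed.

Lemma valN x : v (- x) = v x.
Proof. by rewrite -mulN1r valM valN1 ext_add0. Qed.

Definition int_pred : {pred K} := [pred x | Fin 0 <= v x].

Lemma ext_add_ge0 (x y : ext G) : Fin 0 <= x -> Fin 0 <= y -> Fin 0 <= ext_add x y.
Proof.
case: x y => [a||] [b||] //=; rewrite !/(Fin _ <= Fin _) /= => a0 b0.
by apply: le_trans a0 _; have := ozmod_leD2l a _ _ b0; rewrite addr0.
Qed.

Lemma ext_add_gt0 (x y : ext G) : Fin 0 <= x -> Fin 0 < y -> Fin 0 < ext_add x y.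
Proof.
move=> x0 y0; have xy0 := ext_add_ge0 x0 (ltW y0); move: x0 y0 xy0.
case: x y => [a||] [b||] //; rewrite !lt_neqAle => a0 /andP[b0 b0'] -> /[!andbT].
apply: contra_neq b0 => -[ab]; congr Fin; apply/esym/eqP; rewrite eq_le [0 <= b]b0' andbT.
by have := ozmod_leD2l b _ _ (a0 : 0 <= a); rewrite addr0 addrC -ab.
Qed.

Lemma int_subring : subring_closed int_pred.
Proof.
split=> [|x y|x y]; rewrite !inE ?val1 //.
  move=> x0 y0; apply: le_trans (valD v x (- y)).
  by rewrite le_min valN x0 y0.
by rewrite valM; exact: ext_add_ge0.
Qed.

HB.instance Definition _ := GRing.isSubringClosed.Build K int_pred int_subring.

Record val_ring := ValRing { val_ring_val :> K; _ : val_ring_val \in int_pred }.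
HB.instance Definition _ := [isSub for val_ring_val].
HB.instance Definition _ := [Choice of val_ring by <:].
HB.instance Definition _ := [SubChoice_isSubComNzRing of val_ring by <:].

Definition max_ideal : {pred val_ring} := [pred x | Fin 0 < v (val x)].

Lemma max_ideal_closed : idealr_closed max_ideal.
Proof.
split; rewrite ?inE ?rmorph0 ?rmorph1 ?val0 ?val1 ?ltxx // => a x y.
rewrite !inE rmorphD rmorphM => x0 y0; apply: lt_le_trans (valD v _ _).
by rewrite lt_min y0 andbT valM ext_add_gt0 //; exact: (valP a).
Qed.

HB.instance Definition _ := isIdealr.Build val_ring max_ideal max_ideal_closed.

Definition residue_field := {ideal_quot max_ideal}.

HB.instance Definition _ := GRing.ComNzRing.on residue_field.

Definition residue (x : val_ring) : residue_field := \pi x.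

Definition residue_inv (q : residue_field) : residue_field :=
  if q == 0 then 0 else residue (insubd (0 : val_ring) (val (repr q))^-1).

Lemma residue_eq0 (x : val_ring) : (residue x == 0) = (x \in max_ideal).
Proof.
by rewrite /residue -[x in RHS]subr0 Quotient.idealrBE (rmorph0 \pi_residue_field).
Qed.

Lemma residue_mulVf (q : residue_field) : q != 0 -> residue_inv q * q = 1.
Proof.
move=> q0; rewrite /residue_inv (negPf q0).
set x := repr q; have qE : q = residue x by rewrite /residue reprK.
move: q0; rewrite [in X in _ * X]qE {1}qE residue_eq0 inE -leNgt => x_le0.
have vx : v (val x) = Fin 0 by apply/le_anti; rewrite x_le0; exact: (valP x).
have x0 : val x != 0 by apply: contra_eq_neq vx => ->; rewrite val0.
rewrite /residue -(rmorphM \pi_residue_field) -(rmorph1 \pi_residue_field).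
congr (\pi _); apply: val_inj; rewrite rmorphM rmorph1 /= insubdK ?mulVf //.
by rewrite inE (val_fieldV vx) oppr0.
Qed.

Lemma residue_inv0 : residue_inv 0 = 0.
Proof. by rewrite /residue_inv eqxx. Qed.

HB.instance Definition _ :=
  GRing.ComNzRing_isField.Build residue_field residue_mulVf residue_inv0.

End ResidueField.

Section ResidueMap.
Variables (K L : fieldType) (G : orderedZmodType).
Variables (v : valuation L G) (i : {rmorphism K -> L}).

Definition val_ring_map (x : val_ring (pullback v i)) : val_ring v :=
  ValRing (valP x : i (val x) \in int_pred v).

Definition residue_map (q : residue_field (pullback v i)) : residue_field v :=
  residue (val_ring_map (repr q)).

Lemma residue_mapE x : residue_map (residue x) = residue (val_ring_map x).
Proof.
apply/eqP; rewrite -subr_eq0 /residue_map /residue -(rmorphB \pi_(residue_field v)).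
rewrite -/(residue _) residue_eq0 inE rmorphB /=.
have : residue (repr (residue x) - x) == 0.
  rewrite /residue (rmorphB \pi_(residue_field (pullback v i))) subr_eq0.
  by apply/eqP; exact: reprK.
by rewrite residue_eq0 inE rmorphB /= rmorphB.
Qed.

End ResidueMap.

(* i : F -> E makes E a vector space over F with a basis of n elements *)
Definition ext_degree (F E : fieldType) (i : F -> E) (n : nat) : Prop :=
  exists b : 'I_n -> E,
    forall y, exists! c : 'rV[F]_n, y = \sum_j i (c 0 j) * b j.

Section Henselization.

(* Value groups may differ, so extensions and equality of valuations are taken
   up to equivalence, that is, at the level of valuation rings. *)
Definition val_extends (K M : fieldType) (G H : orderedZmodType)
    (v : valuation K G) (w : valuation M H) (i : K -> M) : Prop :=
  forall x, (Fin 0 <= w (i x)) = (Fin 0 <= v x).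

Definition henselian (K : fieldType) (G : orderedZmodType)
    (v : valuation K G) : Prop :=
  forall (M : fieldType) (i : {rmorphism K -> M}),
    (forall z : M, algebraicOver i z) ->
  forall (H1 H2 : orderedZmodType) (w1 : valuation M H1) (w2 : valuation M H2),
    val_extends v w1 i -> val_extends v w2 i -> val_extends w1 w2 id.

Definition is_henselization (K Kh : fieldType) (G Gh : orderedZmodType)
    (v : valuation K G) (vh : valuation Kh Gh)
    (j : {rmorphism K -> Kh}) : Prop :=
  [/\ val_extends v vh j, henselian vh &
    forall (M : fieldType) (H : orderedZmodType) (w : valuation M H)
        (k : {rmorphism K -> M}),
      henselian w -> val_extends v w k ->
      exists2 h : {rmorphism Kh -> M},
        val_extends vh w h /\ h \o j =1 k &
        forall h' : {rmorphism Kh -> M},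
          val_extends vh w h' -> h' \o j =1 k -> h' =1 h].

(* d(L/K,v) = d, where [L^h : K^h] is taken along the embedding of K^h in L^h
   given by the universal property *)
Definition has_defect (K L : fieldType) (G : orderedZmodType)
    (v : valuation L G) (i : {rmorphism K -> L}) (d : nat) : Prop :=
  exists (Kh Lh : fieldType) (GK GL : orderedZmodType)
    (vKh : valuation Kh GK) (vLh : valuation Lh GL)
    (jK : {rmorphism K -> Kh}) (jL : {rmorphism L -> Lh})
    (h : {rmorphism Kh -> Lh}) (n e f : nat),
  [/\ is_henselization (pullback v i) vKh jK,
      is_henselization v vLh jL,
      val_extends vKh vLh h /\ h \o jK =1 jL \o i,
      [/\ ext_degree h n,
          group_index (value_group v) (value_group (pullback v i)) e &
          ext_degree (@residue_map K L G v i) f] &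
      n = (d * e * f)%N].

End Henselization.

(* A cut is represented by its lower cut set, so that equality and the strict
   order of cuts are `=` and `` `<` `` on sets. *)
Section Cuts.
Variable G : orderedZmodType.

Definition cut_above (S : set (ext G)) : set G :=
  [set g | exists2 s, S s & Fin g <= s].

Definition cut_below (S : set (ext G)) : set G :=
  [set g | forall s, S s -> Fin g < s].

Definition cut_shift (a : G) (D : set G) : set G := [set a + g | g in D].

Definition convex_subgroup (H : set G) : Prop :=
  [/\ H 0, forall x y, H x -> H y -> H (x - y) &
      forall x y z, H x -> H z -> x <= y -> y <= z -> H y].

End Cuts.

Section Expansion.
Variable K : fieldType.
Implicit Types f Q : {poly K}.

(* The coefficient of Q^i in the Q-expansion of f; see expansionE. *)
Definition expansion_coef Q f (i : nat) : {poly K} := (f %/ Q ^+ i) %% Q.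

Lemma size_expansion_coef Q f i :
  (1 < size Q)%N -> (size (expansion_coef Q f i) < size Q)%N.
Proof. by move=> Q1; rewrite ltn_modp -size_poly_gt0 ltnW. Qed.

Lemma expansionE Q f : (1 < size Q)%N ->
  f = \sum_(i < size f) expansion_coef Q f i * Q ^+ i.
Proof.
move=> Q1; have Q0 : Q != 0 by rewrite -size_poly_gt0 ltnW.
have S n : f %/ Q ^+ n * Q ^+ n =
    f %/ Q ^+ n.+1 * Q ^+ n.+1 + expansion_coef Q f n * Q ^+ n.
  by rewrite {1}(divp_eq (f %/ Q ^+ n) Q) divp_divl -exprSr mulrDl -mulrA -exprS.
have E n : f = f %/ Q ^+ n * Q ^+ n + \sum_(i < n) expansion_coef Q f i * Q ^+ i.
  elim: n => [|n IHn]; first by rewrite big_ord0 addr0 expr0 divp1 mulr1.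
  by rewrite {1}IHn S big_ord_recr /= -addrA [X in _ + X]addrC.
rewrite {1}(E (size f)) divp_small ?mul0r ?add0r //.
rewrite -[X in (_ < X)%N]prednK ?size_poly_gt0 ?expf_neq0 // ltnS size_exp.
by rewrite leq_pmull // -subn1 subn_gt0.
Qed.

End Expansion.

Section KeyPolynomials.
Variables (K : fieldType) (G : orderedZmodType) (nu : valuation {poly K} G).
Variables (Kbar : closedFieldType) (iota : {rmorphism K -> Kbar}).
Variable nubar : valuation {poly Kbar} G.
Implicit Types (f Q F : {poly K}) (n b D : nat).

Definition is_algebraic_closure : Prop := forall z : Kbar, algebraicOver iota z.

Definition is_poly_extension : Prop :=
  forall f, nubar (map_poly iota f) = nu f.

Definition roots_in_closure f : seq Kbar :=
  sval (closed_field_poly_normal (map_poly iota f)).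

Definition epsilon f : ext G :=
  \big[Order.max/NInf]_(r <- roots_in_closure f) nubar ('X - r%:P).

Definition key_polynomial Q : Prop :=
  [/\ Q \is monic, (1 < size Q)%N &
      forall f, f != 0 -> (size f < size Q)%N -> epsilon f < epsilon Q].

Definition Psi n : set {poly K} :=
  [set Q | key_polynomial Q /\ size Q = n.+1].

Definition key_polynomial_for n F : Prop :=
  [/\ key_polynomial F, (n.+1 < size F)%N &
      forall Q, key_polynomial Q -> (n.+1 < size Q)%N -> (size F <= size Q)%N].

Definition plateau n : Prop :=
  Psi n !=set0 /\
  ~ exists2 Q, Psi n Q & forall Q', Psi n Q' -> nu Q' <= nu Q.

Definition limit_key_polynomial n F : Prop :=
  plateau n /\ key_polynomial_for n F.

(* The truncated valuation nu_Q. *)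
Definition truncation Q f : ext G :=
  \big[Order.min/PInf]_(i < size f | expansion_coef Q f i != 0)
    nu (expansion_coef Q f i * Q ^+ i).

(* For a plateau Psi n, a limit key polynomial F for it, and D the common degree
   in Q of the Q-expansions of F for Q in Psi n. *)
Definition delta n F : set G :=
  cut_above [set truncation Q F | Q in Psi n].

Definition Bset n F D : set nat :=
  [set b | (0 < b < D)%N /\
    exists2 Q0, Psi n Q0 &
      forall Q, Psi n Q -> nu Q0 <= nu Q ->
        exists2 g, delta n F g & nu (expansion_coef Q F b * Q ^+ b) = Fin g].

End KeyPolynomials.

Variant defect_case := ArtinSchreier | Kummer.

Section Dependence.
Variables (K : fieldType) (L : fieldExtType K) (G : orderedZmodType).
Variables (v : valuation L G) (p : nat) (eta : L).

(* The conditions special to each case, for eta with minimal polynomial g. *)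
Definition case_assumption (c : defect_case) (g : {poly K}) (a : K) : Prop :=
  match c with
  | ArtinSchreier => p \in [pchar K] /\ g = 'X^p - 'X - a%:P
  | Kummer => [/\ exists z : K, p.-primitive_root z,
                  g = 'X^p - a%:P & v a%:A = Fin 0]
  end.

Definition dist : set G := cut_above [set v (eta - b%:A) | b in [set: K]].

Definition subgroup_cut (H : set G) : set G :=
  cut_below [set Fin h | h in H].

(* In the Kummer case, d is v(p)/(p-1). *)
Definition independent (c : defect_case) : Prop :=
  match c with
  | ArtinSchreier => exists2 H, convex_subgroup H & dist = subgroup_cut H
  | Kummer => exists H d, [/\ convex_subgroup H, v p%:R = Fin (d *+ p.-1) &
                dist = cut_shift d (subgroup_cut H)]
  end.

Definition dependent (c : defect_case) : Prop := ~ independent c.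

End Dependence.

Definition val_of_root (K : fieldType) (L : fieldExtType K)
    (G : orderedZmodType) (v : valuation L G) (eta : L) :
  valuation {poly K} G := pullback v (horner_alg eta).

(* Main.v *)
(** Write [gam b] for [v (eta - b)], with [b] in [K].

    The subfield [K^h(eta)] of [L^h] is henselian, so it equals [L^h] and
    [[L^h : K^h] <= p]; the defect then forces [vL = vK], [Lv = Kv] and makes
    the powers of [eta] a basis of [L^h] over [K^h]. Hence [gam] has no maximum,
    and every other root [eta'] of [g] satisfies [v (eta' - eta) > gam b] for
    all [b], because [K^h] is henselian. With [d = 0] in the Artin-Schreier case
    and [d = v(p)/(p-1)] in the Kummer case this gives [gam b < d] and
    [v (g b) = p gam b].

    For every nonzero [f] the value [v (f b)] is eventually of the form
    [const + s gam b], where the slope [s] is the number of roots of [f] that are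
    closer to [eta] than all [b] in [K]. The slope of [g] is its degree [p]. A
    key polynomial of degree strictly between 1 and [p] would have positive
    slope; but the minimal degree of a polynomial of positive slope is at least
    2 and divides [p]. So [g] is a limit key polynomial.

    In the [(X - b)]-expansion of [g] the constant and the top term have value
    [p gam b], the linear term has value [(p-1)d + gam b], and the other terms
    have at least that value. So [delta_g] is generated by the [p gam b], and
    [B(g)] is nonempty iff every [gam b - d] is at most some [p (gam c - d)].
    Since [Gamma] is divisible, this says that the cut generated by the
    [gam b - d] is the lower edge of a convex subgroup. *)

Require Import Defs.
From HB Require Import structures.
From mathcomp Require Import all_boot all_order all_algebra all_field.
From mathcomp Require Import generic_quotient ring_quotient.
From mathcomp Require Import zify ring.
From mathcomp Require Import boolp classical_sets cardinality.

Set Implicit Arguments.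
Unset Strict Implicit.
Unset Printing Implicit Defensive.

Import Order.TTheory GRing.Theory.

Local Open Scope ring_scope.
Local Open Scope classical_set_scope.

(** * Ordered groups and valuations *)

Section OrderedGroup.
Variable G : orderedZmodType.
Implicit Types (x y z t : G) (u w : ext G) (n m : nat).

Lemma ext_leFin x y : ((Fin x : ext G) <= Fin y) = (x <= y).
Proof. by []. Qed.

Lemma ext_ltFin x y : ((Fin x : ext G) < Fin y) = (x < y).
Proof.
by rewrite !lt_def ext_leFin; congr andb; congr negb; apply/eqP/eqP => [[]|->].
Qed.

(** The library's lemmas on total orders apply to [ext G], not to [G], so totality is used through
    [Fin]. *)
Lemma ozmod_leNgt x y : (x <= y) = ~~ (y < x).
Proof. by rewrite -ext_ltFin -leNgt. Qed.

Lemma ozmod_ltNge x y : (x < y) = ~~ (y <= x).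
Proof. by rewrite ozmod_leNgt negbK. Qed.

Lemma ozmod_leDl z x y : (z + x <= z + y) = (x <= y).
Proof.
apply/idP/idP => [/(ozmod_leD2l (- z))|]; last exact: ozmod_leD2l.
by rewrite !addKr.
Qed.

Lemma ozmod_leDr z x y : (x + z <= y + z) = (x <= y).
Proof. by rewrite ![_ + z]addrC ozmod_leDl. Qed.

Lemma ozmod_ltDl z x y : (z + x < z + y) = (x < y).
Proof. by rewrite !ozmod_ltNge ozmod_leDl. Qed.

Lemma ozmod_ltDr z x y : (x + z < y + z) = (x < y).
Proof. by rewrite !ozmod_ltNge ozmod_leDr. Qed.

Lemma ozmod_leD x y z t : x <= y -> z <= t -> x + z <= y + t.
Proof.
by move=> xy zt; apply: (@le_trans _ _ (y + z)); rewrite ?ozmod_leDl ?ozmod_leDr.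
Qed.

Lemma ozmod_leN x y : (- x <= - y) = (y <= x).
Proof. by rewrite -(ozmod_leDl (x + y) (- x)) addrK [x + y]addrC addrK. Qed.

Lemma ozmod_ltN x y : (- x < - y) = (y < x).
Proof. by rewrite !ozmod_ltNge ozmod_leN. Qed.

Lemma ozmod_subr_lt0 x y : (x - y < 0) = (x < y).
Proof. by rewrite -(ozmod_ltDr y (x - y)) subrK add0r. Qed.

Lemma ozmod_ltMn n x y : (0 < n)%N -> (x *+ n < y *+ n) = (x < y).
Proof.
case: n => // n _.
have le_mono (a b : G) m : a <= b -> a *+ m <= b *+ m.
  by move=> ab; elim: m => [|m IHm]; rewrite ?mulr0n // !mulrS ozmod_leD.
have lt_mono (a b : G) : a < b -> a *+ n.+1 < b *+ n.+1.
  move=> ab; rewrite !mulrS; apply: (@lt_le_trans _ _ (b + a *+ n)).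
    by rewrite ozmod_ltDr.
  by rewrite ozmod_leDl le_mono // ltW.
apply/idP/idP => [|/lt_mono //]; apply: contraLR.
by rewrite -!ozmod_leNgt; exact: le_mono.
Qed.

Lemma ozmod_leMn n x y : (0 < n)%N -> (x *+ n <= y *+ n) = (x <= y).
Proof. by move=> n0; rewrite !ozmod_leNgt ozmod_ltMn. Qed.

Lemma ozmod_mulrn_inj n x y : (0 < n)%N -> x *+ n = y *+ n -> x = y.
Proof.
by move=> n0 xy; apply/le_anti; rewrite -(ozmod_leMn x y n0) -(ozmod_leMn y x n0) xy lexx.
Qed.

Lemma ext_addC : commutative (@ext_add G).
Proof. by case=> [x||] [y||] //=; rewrite addrC. Qed.

Lemma ext_leP u : u <= PInf.
Proof. by case: u. Qed.

End OrderedGroup.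

Section Valuation.
Variables (R : comNzRingType) (G : orderedZmodType) (v : valuation R G).
Implicit Types x y : R.

Lemma val_neqNInf x : v x != NInf.
Proof. by have := val_gtNInf v x; rewrite lt_neqAle eq_sym => /andP[]. Qed.

Lemma val_Fin x : v x != PInf -> exists g, v x = Fin g.
Proof. by move: (val_neqNInf x); case: (v x) => // g; exists g. Qed.

Lemma val_opp1 : v (-1) = Fin 0.
Proof.
have := Defs.valM v (-1) (-1); rewrite mulrNN mulr1 Defs.val1.
case: (v (-1)) => //= g [] /esym; rewrite -mulr2n -(mul0rn G 2).
by move/(ozmod_mulrn_inj (isT : 0 < 2)%N) ->; rewrite mul0rn.
Qed.

Lemma val_opp x : v (- x) = v x.
Proof. by rewrite -mulN1r Defs.valM val_opp1; exact: ext_add0. Qed.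

Lemma val_subC x y : v (x - y) = v (y - x).
Proof. by rewrite -val_opp opprB. Qed.

Lemma valD_lt x y : v x < v y -> v (x + y) = v x.
Proof.
move=> xy; apply/le_anti/andP; split; last first.
  by apply: le_trans (Defs.valD v x y); rewrite le_min lexx ltW.
have := Defs.valD v (x + y) (- y); rewrite addrK val_opp ge_min.
by rewrite [v y <= _]leNgt xy orbF.
Qed.

Lemma valD_le x y (a : ext G) : a <= v x -> a <= v y -> a <= v (x + y).
Proof. by move=> ax ay; apply: le_trans (Defs.valD v x y); rewrite le_min ax. Qed.

Lemma val_nat_ge0 n : Fin 0 <= v n%:R.
Proof.
elim: n => [|n IHn]; first by rewrite Defs.val0 ext_leP.
by rewrite -addn1 natrD valD_le // Defs.val1.
Qed.

Lemma valX x g n : v x = Fin g -> v (x ^+ n) = Fin (g *+ n).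
Proof.
move=> xg; elim: n => [|n IHn]; first by rewrite expr0 Defs.val1.
by rewrite exprS Defs.valM xg IHn /= mulrS.
Qed.

End Valuation.

(** * Henselizations and the defect *)

(** The chosen section [s] of [f] need not be a morphism, but [g \o s] is one, since [g] vanishes on
    the kernel of [f]. *)
Lemma rmorph_factor (A B C : nzRingType) (f : {rmorphism A -> B})
    (g : {rmorphism A -> C}) :
  (forall b, exists a, f a = b) -> (forall a, f a = 0 -> g a = 0) ->
  exists r : {rmorphism B -> C}, forall a, r (f a) = g a.
Proof.
move=> /choice[s fs] kerfg.
have gE a b : f a = b -> g (s b) = g a.
  by move=> fab; apply/eqP; rewrite -subr_eq0 -rmorphB kerfg // rmorphB fs fab subrr.
have r_zmod : zmod_morphism (g \o s).
  by move=> x y /=; rewrite -rmorphB; apply: gE; rewrite rmorphB !fs.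
have r_monoid : monoid_morphism (g \o s).
  split=> [|x y] /=; first by rewrite -(rmorph1 g); apply: gE; rewrite rmorph1.
  by rewrite -rmorphM; apply: gE; rewrite rmorphM !fs.
pose r : {rmorphism B -> C} := HB.pack (g \o s)
  (GRing.isZmodMorphism.Build B C (g \o s) r_zmod)
  (GRing.isMonoidMorphism.Build B C (g \o s) r_monoid).
by exists r => a; exact: gE.
Qed.

Lemma rmorph_lift (A B C : nzRingType) (f : {rmorphism A -> C})
    (g : {rmorphism B -> C}) :
  injective g -> (forall a, exists b, g b = f a) ->
  exists k : {rmorphism A -> B}, forall a, g (k a) = f a.
Proof.
move=> g_inj /choice[k gk].
have k_zmod : zmod_morphism k by move=> x y; apply: g_inj; rewrite !rmorphB !gk rmorphB.
have k_monoid : monoid_morphism k.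
  by split=> [|x y]; apply: g_inj; rewrite ?rmorph1 ?rmorphM !gk ?rmorph1 ?rmorphM.
pose k' : {rmorphism A -> B} := HB.pack k
  (GRing.isZmodMorphism.Build A B k k_zmod) (GRing.isMonoidMorphism.Build A B k k_monoid).
by exists k'.
Qed.

Section AlgebraicOver.
Variables (F E : fieldType) (i : {rmorphism F -> E}).

Lemma algebraicOver_horner z (q : {poly F}) :
  algebraicOver i z -> algebraicOver i (map_poly i q).[z].
Proof.
move=> /integral_algebraic zi; apply/integral_algebraic/integral_horner => //.
by apply/integral_poly => k; rewrite coef_map; exact: integral_id.
Qed.

Lemma algebraicOver_trans (M : fieldType) (j : {rmorphism E -> M}) :
  (forall y, algebraicOver i y) ->
  forall z, algebraicOver j z -> algebraicOver (j \o i) z.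
Proof.
move=> algE z [q q0 qz]; apply/integral_algebraic.
apply: (integral_root _ qz); first by rewrite map_poly_eq0.
apply/integral_poly => k; rewrite coef_map; apply: integral_rmorph.
exact/integral_algebraic.
Qed.

Lemma algebraicOver_inj (M : fieldType) (j : {rmorphism E -> M}) z :
  algebraicOver (j \o i) (j z) -> algebraicOver i z.
Proof.
move=> [q q0]; rewrite map_poly_comp => qz; exists q => //.
by move: qz; rewrite fmorph_root.
Qed.

(** Extensions of [w] to a field algebraic over [E] also extend [v], and that field is algebraic
    over [F] by transitivity. *)
Lemma henselian_algebraic (G H : orderedZmodType)
    (v : valuation F G) (w : valuation E H) :
  henselian v -> val_extends v w i -> (forall y, algebraicOver i y) -> henselian w.
Proof.
move=> hv vw algE M j algM H1 H2 w1 w2 ww1 ww2.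
apply: (hv M (j \o i)) => [z|x|x] /=; last 2 first.
- by rewrite ww1 vw.
- by rewrite ww2 vw.
exact: algebraicOver_trans.
Qed.

End AlgebraicOver.

Lemma mulmx1C_eq (R : comNzRingType) (m n : nat) (A : 'M[R]_(m, n)) (B : 'M[R]_(n, m)) :
  m = n -> A *m B = 1%:M -> B *m A = 1%:M.
Proof. by move=> mn; case: _ / mn in A B *; exact: mulmx1C. Qed.

Section Generated.
Variables (F E : fieldType) (i : {rmorphism F -> E}) (z : E) (P : {poly F}).
Hypotheses (Pmonic : P \is monic) (Pz : root (map_poly i P) z).

Lemma horner_modp q : (map_poly i (q %% P)).[z] = (map_poly i q).[z].
Proof.
rewrite {2}(divp_eq q P) rmorphD rmorphM hornerD hornerM.
by rewrite (rootP Pz) mulr0 add0r.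
Qed.

Hypothesis gen : forall y, exists q : {poly F}, y = (map_poly i q).[z].

(** [MA] and [MB] translate between the basis [b] and the powers of [z] below the degree of [P].
    Their product [MA *m MB] is the identity, which bounds [n]. If both matrices are square, the
    other product is the identity too, so these powers are independent and [P] is the minimal
    polynomial of [z]. *)
Lemma ext_degree_generator n : ext_degree i n ->
  (n <= (size P).-1)%N /\
  (n = (size P).-1 -> forall q : {poly F}, (map_poly i q).[z] = 0 -> P %| q).
Proof.
move=> [b bP]; set d := (size P).-1; pose e (k : 'I_d) := z ^+ k.
have P0 : P != 0 by exact: monic_neq0.
have sizeP : size P = d.+1 by rewrite prednK // size_poly_gt0.
have rVE (q : {poly F}) : (size q <= d)%N ->
    (map_poly i q).[z] = \sum_k i (poly_rV q 0 k : F) * e k.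
  move=> qd; rewrite (@horner_coef_wide _ d) ?size_map_poly //.
  by apply: eq_bigr => k _; rewrite coef_map mxE.
have be j : exists c : 'rV[F]_d, b j = \sum_k i (c 0 k) * e k.
  have [q ->] := gen (b j); exists (poly_rV (q %% P)); rewrite -horner_modp.
  by apply: rVE; rewrite -ltnS -sizeP ltn_modp.
have {be}[A bA] := choice be.
have eb k : exists c : 'rV[F]_n, e k = \sum_j i (c 0 j) * b j.
  by have [c [-> _]] := bP (e k); exists c.
have {eb}[B eB] := choice eb.
pose MA := \matrix_(j, k) A j 0 k; pose MB := \matrix_(k, j) B k 0 j.
have bMA m (c : 'rV[F]_m) (N : 'M[F]_(m, n)) (f : 'I_m -> E) :
    (forall k, f k = \sum_j i (N k j) * b j) ->
    \sum_k i (c 0 k) * f k = \sum_j i ((c *m N) 0 j) * b j.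
  move=> fN; under eq_bigr do rewrite fN mulr_sumr.
  rewrite exchange_big; apply: eq_bigr => j _ /=.
  rewrite mxE rmorph_sum mulr_suml; apply: eq_bigr => k _.
  by rewrite rmorphM mulrA.
have b_inj (c c' : 'rV[F]_n) :
    \sum_j i (c 0 j) * b j = \sum_j i (c' 0 j) * b j -> c = c'.
  move=> cc'; have [x [_ xP]] := bP (\sum_j i (c 0 j) * b j).
  by rewrite -(xP c) // -(xP c').
have eMB k : e k = \sum_j i (MB k j) * b j.
  by rewrite eB; apply: eq_bigr => j _; rewrite mxE.
have AB : MA *m MB = 1%:M.
  apply/row_matrixP => j; apply: b_inj; rewrite row_mul.
  rewrite -(bMA _ _ _ _ eMB).
  transitivity (b j).
    by rewrite bA; apply: eq_bigr => k _; rewrite !mxE.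
  rewrite (bigD1 j) //= !mxE eqxx rmorph1 mul1r big1 ?addr0 // => l lj.
  by rewrite !mxE eq_sym (negPf lj) rmorph0 mul0r.
split=> [|nd q qz]; first exact: mulmx1_min AB.
have BA : MB *m MA = 1%:M by exact: mulmx1C_eq AB.
have rd : (size (q %% P)%R <= d)%N by rewrite -ltnS -sizeP ltn_modp.
have r0 : poly_rV (q %% P) = 0 :> 'rV[F]_d.
  rewrite -[LHS]mulmx1 -BA mulmxA [X in X *m _](_ : _ = 0) ?mul0mx //.
  apply: b_inj; rewrite -(bMA _ _ _ _ eMB) -rVE // horner_modp qz big1 // => j _.
  by rewrite mxE rmorph0 mul0r.
by rewrite /dvdp -(poly_rV_K rd) r0 linear0.
Qed.

End Generated.

(* Kh(z) is henselian and contains L, so the universal property retracts Lh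
   onto it. *)
Lemma henselization_generated (L Lh Kh : fieldType) (G GL GK : orderedZmodType)
    (v : valuation L G) (vLh : valuation Lh GL) (vKh : valuation Kh GK)
    (jL : {rmorphism L -> Lh}) (h : {rmorphism Kh -> Lh}) (z : Lh) (P : {poly Kh}) :
  is_henselization v vLh jL -> henselian vKh -> val_extends vKh vLh h ->
  P != 0 -> root (map_poly h P) z ->
  (forall l, exists q : {poly Kh}, jL l = (map_poly h q).[z]) ->
  forall y, exists q : {poly Kh}, y = (map_poly h q).[z].
Proof.
move=> [vjL hLh univ] hKh vh P0 Pz Lgen y.
pose E : fieldType := subFExtend h z P.
pose s : {rmorphism E -> Lh} := subfx_inj (iota := h) (z := z) (p := P).
pose i : {rmorphism Kh -> E} := inj_subfx h z P.
have sE (q : {poly Kh}) : s (subfx_eval h z P q) = (map_poly h q).[z].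
  exact: subfx_inj_eval.
have si x : s (i x) = h x by rewrite sE map_polyC hornerC.
have [k sk] : exists k : {rmorphism L -> E}, forall l, s (k l) = jL l.
  apply: rmorph_lift (fmorph_inj s) _ => l.
  by have [q ->] := Lgen l; exists (subfx_eval h z P q); rewrite sE.
have hE : henselian (pullback vLh s).
  apply: (henselian_algebraic (i := i) hKh) => [x|x].
    by rewrite /= si vh.
  apply: (algebraicOver_inj (j := s)).
  have -> : algebraicOver (s \o i) (s x) = algebraicOver h (s x).
    congr (exists2 q, _ & _); apply/funext => q; congr (is_true (root _ _)).
    exact: eq_map_poly.
  by have [q ->] := subfxE x; rewrite sE; apply: algebraicOver_horner; exists P.
have [|r [vr rk] _] := univ E GL (pullback vLh s) k hE.
  by move=> x; rewrite /= sk vjL.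
(* By uniqueness in the universal property of [Lh], both [s \o r] and the identity equal [t]; hence
   [s] is onto. *)
have [t [vt tj] tU] := univ Lh GL vLh jL hLh vjL.
have sr : s \o r =1 t.
  have vsr : val_extends vLh vLh (s \o r) by move=> x; rewrite -(vr x).
  by apply: (tU (s \o r)) => // x /=; rewrite [r _]rk sk.
have idt : idfun =1 t by apply: (tU (idfun : {rmorphism Lh -> Lh})).
have [q rq] := subfxE (r y); exists q.
by rewrite -sE -rq [LHS](idt y) -sr.
Qed.

Section GroupIndex.
Variables (G : orderedZmodType) (A B : set G).
Hypotheses (A0 : A 0) (B0 : B 0).

Lemma group_index_gt0 e : group_index A B e -> (0 < e)%N.
Proof.
case: e => //; rewrite /group_index II0 card_eq0 => /eqP /seteqP[].
by move=> /(_ [set 0 + b | b in B]) /(_ (ex_intro2 _ _ _ A0 erefl)).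
Qed.

Lemma group_index1_sub : group_index A B 1 -> A `<=` B.
Proof.
move=> /eq_cardSP[C _]; rewrite II0 card_eq0 => /eqP C0 a Aa.
have CE x : A x -> [set x + b | b in B] = C.
  move=> Ax; have [//|xC] := EM ([set x + b | b in B] = C).
  suff : @set0 (set G) [set x + b | b in B] by [].
  by rewrite -C0; split=> //; exists x.
have : C a by rewrite -(CE a Aa); exists 0; rewrite ?addr0.
by rewrite -(CE 0 A0) => -[b Bb]; rewrite add0r => <-.
Qed.

End GroupIndex.

Section Residue.
Local Open Scope quotient_scope.
Variables (K L : fieldType) (G : orderedZmodType) (v : valuation L G).
Variable i : {rmorphism K -> L}.

Lemma residue_degree_gt0 f : ext_degree (@residue_map K L G v i) f -> (0 < f)%N.
Proof.
case: f => // -[b bP]; have [c [/eqP + _]] := bP 1.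
by rewrite big_ord0 oner_eq0.
Qed.

(** The basis vector [b 0] need not be 1. Writing both the residue of [l] and 1 as multiples of it,
    with coefficients coming from [x] and [x1], makes it cancel, and [x / x1] approximates [l]. *)
Lemma residue_degree1 l : ext_degree (@residue_map K L G v i) 1 ->
  v l = Fin 0 -> exists c : K, Fin 0 < v (l - i c).
Proof.
move=> [b bP] vl.
have resE y : exists x : val_ring (pullback v i), y = residue (val_ring_map x) * b 0.
  have [c [-> _]] := bP y; exists (repr (c 0 0)).
  by rewrite big_ord1 -residue_mapE /residue reprK.
have lP : l \in int_pred v by rewrite inE vl.
have [x xE] := resE (residue (ValRing lP)); have [x1 x1E] := resE 1.
have vx1 : v (i (val x1)) = Fin 0.
  apply/eqP; rewrite eq_le [X in _ && X](valP (val_ring_map x1)) andbT leNgt.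
  apply/negP => x10; have : residue (val_ring_map x1) == 0 by rewrite residue_eq0.
  by move=> /eqP x10'; move/eqP: x1E; rewrite x10' mul0r oner_eq0.
have ix1 : i (val x1) != 0 by apply: contra_eq_neq vx1 => ->; rewrite Defs.val0.
have : residue (ValRing lP * val_ring_map x1 - val_ring_map x) == 0.
  rewrite /residue (rmorphB \pi_(residue_field v)) (rmorphM \pi_(residue_field v)).
  rewrite -[X in X == 0]/(residue (ValRing lP) * residue (val_ring_map x1)
    - residue (val_ring_map x)).
  rewrite xE mulrAC -mulrA -x1E mulr1.
  by rewrite subrr.
rewrite residue_eq0 inE rmorphB rmorphM /= => vlx.
exists (val x / val x1); rewrite fmorph_div.
have -> : l - i (val x) / i (val x1) = (l * i (val x1) - i (val x)) * (i (val x1))^-1.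
  by rewrite mulrBl mulfK.
by rewrite Defs.valM (val_fieldV vx1) oppr0 ext_addC ext_add0.
Qed.

End Residue.

Section Defect.
Variables (K : fieldType) (L : fieldExtType K) (G : orderedZmodType).
Variables (v : valuation L G) (p : nat) (eta : L) (g : {poly K}).
Hypotheses (p_gt0 : (0 < p)%N) (hd : has_defect v (in_alg L) p).
Hypotheses (gmonic : g \is monic) (sizeg : size g = p.+1).
Hypothesis geta : root (map_poly (in_alg L) g) eta.
Hypothesis Lgen : forall l, exists q : {poly K}, l = (map_poly (in_alg L) q).[eta].

(** [Lh] is generated by [jL eta] over [Kh], so [n <= p]; with [n = p * e * f] this forces
    [e = f = 1] and [n = p]. Then [P] is the minimal polynomial of [jL eta], and [jL eta] can be
    sent to [jL eta'] by an endomorphism of [Lh] over [Kh], which preserves integrality because [Kh]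
    is henselian. *)
Lemma has_defect_unibranched :
  [/\ forall l a, v l = Fin a -> exists c : K, v c%:A = Fin a,
      forall l, v l = Fin 0 -> exists c : K, Fin 0 < v (l - c%:A) &
      forall eta', root (map_poly (in_alg L) g) eta' -> forall q : {poly K},
        (Fin 0 <= v (map_poly (in_alg L) q).[eta']) =
        (Fin 0 <= v (map_poly (in_alg L) q).[eta])].
Proof.
have [Kh [Lh [GK [GL [vKh [vLh [jK [jL [h [n [e [f]]]]]]]]]]]] := hd.
move=> [[vjK hKh _] hLh [vh hj] [hn he hf] nE].
pose P := map_poly jK g.
have Pmonic : P \is monic by rewrite map_monic.
have mapE (q : {poly K}) x :
    jL (map_poly (in_alg L) q).[x] = (map_poly h (map_poly jK q)).[jL x].
  rewrite -horner_map -!map_poly_comp; congr (_.[_]).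
  by apply: eq_map_poly => c /=; rewrite -[jL _]hj.
have Pz x : root (map_poly (in_alg L) g) x -> root (map_poly h P) (jL x).
  by move=> /rootP gx; apply/rootP; rewrite -mapE gx rmorph0.
have gen := henselization_generated hLh hKh vh (monic_neq0 Pmonic) (Pz _ geta).
have {}gen : forall y, exists q : {poly Kh}, y = (map_poly h q).[jL eta].
  by apply: gen => l; have [q ->] := Lgen l; exists (map_poly jK q).
have sizeP : (size P).-1 = p by rewrite size_map_poly sizeg.
have [np nP] := ext_degree_generator Pmonic (Pz _ geta) gen hn.
rewrite sizeP in np nP.
have vg0 (F : fieldType) (w : valuation F G) : value_group w 0.
  by exists 1; exact: Defs.val1.
have e0 := group_index_gt0 (vg0 _ _) he.
have f0 := residue_degree_gt0 hf.
have : (e * f <= 1)%N by rewrite -(leq_pmul2l p_gt0) muln1 mulnA -nE.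
move: e0 f0 he hf nE; case: e => [|[|e]] //; case: f => [|[|f]] //.
move=> _ _ he hf; rewrite !muln1 => /nP kerP _; split.
- move=> l a la; have [|c ca] := group_index1_sub (vg0 _ _) (vg0 _ _) he (_ : _ a).
    by exists l.
  by exists c.
- by move=> l; exact: residue_degree1 hf.
move=> eta' geta' q.
pose ev x : {rmorphism {poly Kh} -> Lh} := horner_eval x \o map_poly h.
have evC x c : ev x c%:P = h c.
  by rewrite /ev /= /horner_eval map_polyC hornerC.
have [s sE] : exists s : {rmorphism Lh -> Lh},
    forall r : {poly Kh}, s (ev (jL eta) r) = ev (jL eta') r.
  apply: rmorph_factor => [y|r]; first by have [r ->] := gen y; exists r.
  move=> /kerP /dvdpP[r' ->]; apply/rootP.
  by rewrite rmorphM rootM (Pz _ geta') orbT.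
have vs : val_extends vLh (pullback vLh s) idfun.
  apply: (hKh Lh h) => // [y|x].
    have [r ->] := gen y; apply: algebraicOver_horner.
    by exists P; [exact: monic_neq0 | exact: Pz].
  by rewrite -[pullback vLh s _]/(vLh (s (h x))) -(evC (jL eta)) sE evC vh.
have [vjL _ _] := hLh.
rewrite -!vjL !mapE -[LHS]/(Fin 0 <= vLh (ev (jL eta') (map_poly jK q))).
by rewrite -sE -[LHS]/(Fin 0 <= pullback vLh s _) vs.
Qed.

End Defect.

(** * Slopes and key polynomials *)

Section BigMax.
Variables (G : orderedZmodType) (I : eqType) (F : I -> ext G).

Lemma ext_bigmax_attained (r : seq I) :
  \big[Order.max/NInf]_(i <- r) F i = NInf \/
  exists2 i, i \in r & \big[Order.max/NInf]_(i <- r) F i = F i.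
Proof.
elim: r => [|j r IHr]; first by rewrite big_nil; left.
rewrite big_cons; case: leP => [_|_]; last by right; exists j; rewrite ?mem_head.
case: IHr => [|[i ir]] ->; first by left.
by right; exists i; rewrite // in_cons ir orbT.
Qed.

Lemma ext_le_bigmax (r : seq I) i : i \in r -> F i <= \big[Order.max/NInf]_(i <- r) F i.
Proof.
elim: r => // j r IHr; rewrite in_cons big_cons le_max => /orP[/eqP <-|/IHr ->].
  by rewrite lexx.
by rewrite orbT.
Qed.

End BigMax.

Section Slope.
Variables (K : fieldType) (L : fieldExtType K) (G : orderedZmodType).
Variables (v : valuation L G) (gam : K -> G).
Hypothesis nomax : forall b, exists c, gam b < gam c.
Implicit Types (f h r : {poly K}) (s t : nat).

(* In the application [gam b] is [v (eta - b)]: [b] tends to [eta] when [gam b]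
   grows. *)
Definition slope f s := exists a b0, forall b, gam b0 <= gam b ->
  v (f.[b])%:A = Fin (a + gam b *+ s).

Lemma gam_max b c : exists d, [/\ gam b <= gam d & gam c <= gam d].
Proof. by have /orP[bc|cb] := ozmod_total (gam b) (gam c); [exists c | exists b]. Qed.

(** Subtracting the equations at two points with different [gam] eliminates [a] and [a']; torsion
    freeness of [G] does the rest. *)
Lemma affine_slope_inj a a' s t b0 :
  (forall b, gam b0 <= gam b -> a + gam b *+ s = a' + gam b *+ t) -> s = t.
Proof.
move=> E; have [b1 b01] := nomax b0.
have E0 := E b0 (lexx _); have E1 := E b1 (ltW b01).
pose x := gam b1 - gam b0.
have x0 : x != 0 by rewrite subr_eq0; apply: contraTneq b01 => ->; rewrite ltxx.
have Ex : x *+ s = x *+ t.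
  rewrite !mulrnBl; have -> : gam b1 *+ s = a' - a + gam b1 *+ t.
    by rewrite -(addKr a (gam b1 *+ s)) E1 addrA [- a + a']addrC.
  have -> : gam b0 *+ s = a' - a + gam b0 *+ t.
    by rewrite -(addKr a (gam b0 *+ s)) E0 addrA [- a + a']addrC.
  by rewrite opprD addrACA subrr add0r.
have aux m n : (m < n)%N -> x *+ m = x *+ n -> False.
  move=> mn xmn; move/eqP: x0; apply.
  apply: (@ozmod_mulrn_inj G (n - m)); rewrite ?subn_gt0 //.
  by rewrite mul0rn mulrnBr ?xmn ?subrr // ltnW.
case: (ltngtP s t) => // [/aux/(_ Ex)//|/aux/(_ (esym Ex))//].
Qed.

Lemma slope_inj f s t : slope f s -> slope f t -> s = t.
Proof.
move=> [a [b0 fs]] [a' [b0' ft]]; have [c [b0c b0'c]] := gam_max b0 b0'.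
apply: (@affine_slope_inj a a' _ _ c) => b cb.
by have := fs b (le_trans b0c cb); rewrite ft ?(le_trans b0'c cb) // => -[].
Qed.

Lemma slopeM f h s t : slope f s -> slope h t -> slope (f * h) (s + t).
Proof.
move=> [a [b0 fs]] [a' [b0' ft]]; have [c [b0c b0'c]] := gam_max b0 b0'.
exists (a + a'), c => b cb; rewrite hornerM -[_%:A]/(in_alg L _) rmorphM Defs.valM.
rewrite [v (in_alg L f.[b])]fs ?(le_trans b0c) //.
by rewrite [v (in_alg L h.[b])]ft ?(le_trans b0'c) //= mulrnDr addrACA.
Qed.

Lemma affine_slope_lt a s b c : (0 < s)%N -> gam b < gam c ->
  a + gam b *+ s < a + gam c *+ s.
Proof. by move=> s0 bc; rewrite ozmod_ltDl ozmod_ltMn. Qed.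

(** Where [h] has smaller value than [r], the values of [f] and [h] agree. If the value of [r] is at
    most that of [h] at one point, it is strictly smaller at all closer points, so the value of [f]
    is constant there, against [0 < t]. *)
Lemma slopeD f h r s t : f = h + r -> slope h s -> slope r 0 -> slope f t ->
  (0 < s)%N -> (0 < t)%N -> s = t.
Proof.
move=> fE [a [bh hs]] [a1 [br rs]] [a2 [bf fs]] s0 t0.
have [c1 [hc1 rc1]] := gam_max bh br; have [c [c1c fc]] := gam_max c1 bf.
have hc := le_trans hc1 c1c; have rc := le_trans rc1 c1c.
have fbE b : (f.[b])%:A = (h.[b])%:A + (r.[b])%:A :> L by rewrite fE hornerD scalerDl.
apply: (@affine_slope_inj a a2 _ _ c) => b cb.
have hsb d (bd : gam b <= gam d) := hs d (le_trans hc (le_trans cb bd)).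
have rsb d (bd : gam b <= gam d) := rs d (le_trans rc (le_trans cb bd)).
have fsb d (bd : gam b <= gam d) := fs d (le_trans fc (le_trans cb bd)).
have [hr|rh] := ltP (v (h.[b])%:A) (v (r.[b])%:A).
  by have := valD_lt hr; rewrite -fbE hsb // fsb // => -[].
have [d bd] := nomax b; have [e de] := nomax d.
have fr d' : gam b < gam d' -> v (f.[d'])%:A = Fin a1.
  move=> bd'; rewrite fbE addrC valD_lt ?rsb ?mulr0n ?addr0 // ?(ltW bd') //.
  rewrite hsb ?(ltW bd') // ext_ltFin; apply: le_lt_trans (affine_slope_lt a s0 bd').
  by move: rh; rewrite rsb // hsb // mulr0n addr0.
have := affine_slope_lt a2 t0 de; have be := lt_trans bd de.
have := fsb d (ltW bd); have := fsb e (ltW be); rewrite !fr // => -[<-] [<-].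
by rewrite ltxx.
Qed.

Hypothesis slope_exists :
  forall f, f != 0 -> exists2 s, (s <= (size f).-1)%N & slope f s.
Hypothesis slope_XsubC : forall b, slope ('X - b%:P) 0.

Lemma slope_linear f s : f != 0 -> (size f <= 2)%N -> slope f s -> s = 0%N.
Proof.
move=> f0 f2 fs; have [f1|f1] := leqP (size f) 1.
  have [t t1 ft] := slope_exists f0; rewrite (slope_inj fs ft).
  by apply/eqP; rewrite -leqn0 (leq_trans t1) // -subn1 leq_subLR.
have /poly2_root[x /factor_theorem[q fq]] : size f = 2 by apply/eqP; rewrite eqn_leq f2.
have q0 : q != 0 by apply: contra_neq f0 => q0; rewrite fq q0 mul0r.
have q1 : size q = 1%N.
  move: f2 f1; rewrite fq size_Mmonic ?monicXsubC // size_XsubC addn2.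
  by case: (size q) => [|[|]].
have [t t1 qt] := slope_exists q0; move: t1; rewrite q1 leqn0 => /eqP t0.
by apply: (slope_inj fs); rewrite fq -[0%N]addn0; apply: slopeM; rewrite // -t0.
Qed.

(* If Q has minimal degree m among the polynomials of positive slope and f has
   slope equal to its degree, then dividing f by Q yields a quotient of the same
   kind, so m divides deg f. *)
Lemma slope_prime (g : {poly K}) p : prime p -> size g = p.+1 -> slope g p ->
  forall f s, f != 0 -> (size f <= p)%N -> slope f s -> s = 0%N.
Proof.
move=> pr_p sg gp f0 s0 f0nz sf0 fs0; apply/eqP.
rewrite -leqn0 leqNgt; apply/negP => s0_gt0.
pose pos n := `[< exists f, [/\ f != 0, size f = n & exists2 s, (0 < s)%N & slope f s] >].
have ex_pos : exists n, pos n.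
  by exists (size f0); apply/asboolP; exists f0; split=> //; exists s0.
case: (ex_minnP ex_pos) => n /asboolP[Q [Q0 sQ [sl sl0 Qsl]]] nmin.
have small f s : f != 0 -> (size f < n)%N -> slope f s -> s = 0%N.
  move=> fnz fn fs; apply/eqP; rewrite -leqn0 leqNgt; apply: contraL fn => s_gt0.
  by rewrite -leqNgt; apply: nmin; apply/asboolP; exists f; split=> //; exists s.
have n3 : (2 < n)%N.
  rewrite ltnNge; apply: contraL sl0 => n2; rewrite -leqNgt leqn0.
  by apply/eqP/(slope_linear Q0 _ Qsl); rewrite sQ.
have np : (n <= p)%N.
  by apply: leq_trans sf0; apply: nmin; apply/asboolP; exists f0; split=> //; exists s0.
have sl_le : (sl <= n.-1)%N.
  by have [t t1 /(slope_inj Qsl) ->] := slope_exists Q0; rewrite -sQ.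
have dvd k f : (size f <= k)%N -> f != 0 -> slope f (size f).-1 ->
    (n.-1 %| (size f).-1)%N.
  elim: k f => [|k IHk] f; first by rewrite leqn0 size_poly_eq0 => /eqP ->; rewrite eqxx.
  move=> fk fnz fsl; have [fn|nf] := ltnP (size f) n.
    by rewrite (small f _ fnz fn fsl).
  pose S : {poly K} := f %/ Q; pose R : {poly K} := f %% Q.
  have fE : f = S * Q + R by exact: divp_eq.
  have sS : size S = (size f - n.-1)%N by rewrite size_divp // sQ.
  have Rn : (size R < n)%N by rewrite -sQ ltn_modp.
  clearbody S R; have Snz : S != 0.
    by rewrite -size_poly_gt0 sS; lia.
  have [t tS St] := slope_exists Snz.
  have SQ := slopeM St Qsl.
  have fst : (t + sl)%N = (size f).-1.
    have [R0|Rnz] := eqVneq R 0.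
      by apply: (slope_inj SQ); rewrite R0 addr0 in fE; rewrite -fE.
    have [u _ Ru] := slope_exists Rnz.
    have u0 := small R u Rnz Rn Ru; rewrite u0 in Ru.
    apply: (slopeD fE SQ Ru fsl); first by rewrite addn_gt0 sl0 orbT.
    by lia.
  (* [t] and [sl] are at most the degrees of [S] and [Q], and their sum is the sum of these degrees;
     so both bounds are attained. *)
  have tE : t = (size S).-1 by lia.
  have -> : (size f).-1 = ((size S).-1 + n.-1)%N by lia.
  by rewrite dvdn_addl // IHk // -?tE //; lia.
have gnz : g != 0 by rewrite -size_poly_eq0 sg.
(* As [n] is a size, the degree is [n.-1]: it divides the prime [p] but lies strictly between 1 and
   [p]. *)
have := dvd _ g (leqnn _) gnz; rewrite sg /= => /(_ gp).
case/primeP: pr_p => _ pr_p /pr_p /orP[] /eqP; lia.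
Qed.

End Slope.

Section RootsInClosure.
Variables (K : fieldType) (G : orderedZmodType).
Variables (Kbar : closedFieldType) (iota : {rmorphism K -> Kbar}).
Variable nubar : valuation {poly Kbar} G.
Implicit Types f Q : {poly K}.

Lemma roots_in_closureE f : map_poly iota f =
  iota (lead_coef f) *: \prod_(z <- roots_in_closure iota f) ('X - z%:P).
Proof.
rewrite /roots_in_closure; case: closed_field_poly_normal => r /= {1}->.
by rewrite lead_coef_map.
Qed.

Lemma mem_roots_in_closure f z : f != 0 ->
  (z \in roots_in_closure iota f) = root (map_poly iota f) z.
Proof.
move=> f0; rewrite roots_in_closureE rootZ ?root_prod_XsubC //.
by rewrite fmorph_eq0 lead_coef_eq0.
Qed.

Lemma size_roots_in_closure f : f != 0 -> size (roots_in_closure iota f) = (size f).-1.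
Proof.
move=> f0; rewrite -(size_map_poly iota f) roots_in_closureE.
rewrite size_scale ?size_prod_XsubC //.
by rewrite fmorph_eq0 lead_coef_eq0.
Qed.

Lemma epsilon_attained f : f != 0 -> (1 < size f)%N ->
  exists2 z, root (map_poly iota f) z & epsilon iota nubar f = nubar ('X - z%:P).
Proof.
rewrite /epsilon => f0 f1; have [e|[z zf ->]] := ext_bigmax_attained
    (fun z => nubar ('X - z%:P)) (roots_in_closure iota f); last first.
  by exists z; rewrite -?mem_roots_in_closure.
have : (0 < size (roots_in_closure iota f))%N.
  by rewrite size_roots_in_closure //; case: (size f) f1 => [|[]].
case: (roots_in_closure iota f) e => // z r e _.
have := ext_le_bigmax (fun z => nubar ('X - z%:P)) (mem_head z r).
by rewrite e leNgt val_gtNInf.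
Qed.

Lemma le_epsilon f z : f != 0 -> root (map_poly iota f) z ->
  nubar ('X - z%:P) <= epsilon iota nubar f.
Proof.
move=> f0; rewrite -mem_roots_in_closure // => zf.
exact: (ext_le_bigmax (fun z => nubar ('X - z%:P))).
Qed.

Lemma epsilon_XsubC b : epsilon iota nubar ('X - b%:P) = nubar ('X - (iota b)%:P).
Proof.
have [||z] := @epsilon_attained ('X - b%:P); rewrite ?polyXsubC_eq0 ?size_XsubC //.
by rewrite rmorphB /= map_polyX map_polyC root_XsubC => /eqP ->.
Qed.

Lemma epsilon_const f : size f = 1%N -> epsilon iota nubar f = NInf.
Proof.
move=> f1; have f0 : f != 0 by rewrite -size_poly_eq0 f1.
rewrite /epsilon; have := size_roots_in_closure f0; rewrite f1 => /size0nil ->.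
by rewrite big_nil.
Qed.

Lemma key_polynomial_XsubC b : key_polynomial iota nubar ('X - b%:P).
Proof.
split; rewrite ?monicXsubC ?size_XsubC // => f f0 f1.
rewrite epsilon_const ?epsilon_XsubC ?val_gtNInf //.
by apply/eqP; rewrite eqn_leq -ltnS f1 size_poly_gt0.
Qed.

Lemma Psi1E Q : Psi iota nubar 1 Q <-> exists b, Q = 'X - b%:P.
Proof.
split=> [[[Qmonic _ _] Q2]|[b ->]]; last first.
  by split; [exact: key_polynomial_XsubC | rewrite size_XsubC].
exists (- Q`_0); rewrite polyCN opprK; apply/polyP => i.
rewrite coefD coefX coefC; case: i => [|[|i]] /=.
- by rewrite add0r.
- by rewrite addr0; move/eqP: Qmonic; rewrite lead_coefE Q2.
by rewrite addr0 nth_default // Q2.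
Qed.

End RootsInClosure.

Section LimitKey.
Variables (K : fieldType) (L : fieldExtType K) (G : orderedZmodType).
Variables (v : valuation L G) (eta : L) (gam : K -> G).
Variables (Kbar : closedFieldType) (iota : {rmorphism K -> Kbar}).
Variable nubar : valuation {poly Kbar} G.
Hypothesis hnubar : is_poly_extension (val_of_root v eta) iota nubar.
Hypothesis gamE : forall b, v (eta - b%:A) = Fin (gam b).
Hypothesis nomax : forall b, exists c, gam b < gam c.
Implicit Types f Q : {poly K}.

Lemma val_of_root_XsubC b : val_of_root v eta ('X - b%:P) = Fin (gam b).
Proof. by rewrite /= rmorphB /= horner_algX horner_algC gamE. Qed.

Lemma nubar_XsubC b : nubar ('X - (iota b)%:P) = Fin (gam b).
Proof.
by rewrite -val_of_root_XsubC -hnubar rmorphB /= map_polyX map_polyC.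
Qed.

Lemma nubarC c : nubar (iota c)%:P = v c%:A.
Proof. by rewrite -map_polyC hnubar /= horner_algC. Qed.

(** Since [nu] evaluates at [eta], the value of ['X - z%:P] stands for that of [eta - z]: a close
    [z] is nearer to [eta] than all of [K]. *)
Definition close z := forall b, Fin (gam b) < nubar ('X - z%:P).

(** On constant polynomials [nubar] is a valuation of [Kbar] that agrees with [v] on [K]. In
    [b - z = (b - X) + (X - z)] the first summand has the smaller value. *)
Lemma nubar_close z b : close z -> nubar (iota b - z)%:P = Fin (gam b).
Proof.
move=> zb.
have -> : (iota b - z)%:P = ((iota b)%:P - 'X) + ('X - z%:P) :> {poly Kbar}.
  by rewrite polyCB addrA subrK.
by rewrite valD_lt // val_subC nubar_XsubC.
Qed.

(** Now [X - z] has the smaller value: [gam b1] bounds it from above, and [gam b0] is larger than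
    [gam b1]. *)
Lemma nubar_far z : ~ close z -> exists a b0, forall b, gam b0 <= gam b ->
  nubar (iota b - z)%:P = Fin a.
Proof.
move=> /existsNP[b1 /negP]; rewrite -leNgt => zb1; have [b0 b01] := nomax b1.
have zlt b : gam b0 <= gam b -> nubar ('X - z%:P) < Fin (gam b).
  by move=> b0b; apply: le_lt_trans zb1 _; rewrite ext_ltFin (lt_le_trans b01).
have [a za] : exists a, nubar ('X - z%:P) = Fin a.
  by apply: val_Fin; apply: contraTneq (zlt b0 (lexx _)) => ->; rewrite -leNgt ext_leP.
exists a, b0 => b /zlt zb; rewrite -za.
have -> : (iota b - z)%:P = ('X - z%:P) + ((iota b)%:P - 'X) :> {poly Kbar}.
  by rewrite polyCB [RHS]addrC addrA subrK.
by rewrite valD_lt // [X in _ < X]val_subC nubar_XsubC.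
Qed.

(** The exponent [s] counts the close entries of [r] with multiplicity; only the bounds used later
    are recorded. *)
Lemma prod_slope (r : seq Kbar) : exists s a b0,
  [/\ (s <= size r)%N, (forall z, z \in r -> close z -> (0 < s)%N) &
      forall b, gam b0 <= gam b ->
        nubar (\prod_(z <- r) (iota b - z))%:P = Fin (a + gam b *+ s)].
Proof.
elim: r => [|z r [s [a [b0 [sr s0 rb]]]]].
  by exists 0%N, 0, 0; split=> // b _; rewrite big_nil Defs.val1 addr0.
have [zc|zf] := EM (close z).
  exists s.+1, a, b0; split=> // b /rb bE.
  by rewrite big_cons polyCM Defs.valM bE nubar_close //= mulrS addrCA.
have [a' [b1 zb]] := nubar_far zf; have [c [b0c b1c]] := gam_max gam b0 b1.
exists s, (a' + a), c; split=> [|z' |b cb]; first exact: leqW.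
  by rewrite in_cons => /orP[/eqP ->|]; last exact: s0.
by rewrite big_cons polyCM Defs.valM zb ?(le_trans b1c) // rb ?(le_trans b0c) //= addrA.
Qed.

Lemma slope_roots f : f != 0 -> exists s,
  [/\ (s <= (size f).-1)%N, slope v gam f s &
    forall z, root (map_poly iota f) z -> close z -> (0 < s)%N].
Proof.
move=> f0; have [s [a [b0 [sr s0 rb]]]] := prod_slope (roots_in_closure iota f).
have [c lc] : exists c, v (lead_coef f)%:A = Fin c.
  by apply: val_field_neq0; rewrite scaler_eq0 lead_coef_eq0 (negPf f0) oner_eq0.
exists s; rewrite -(size_roots_in_closure iota f0); split=> // [|z fz]; last first.
  by apply: s0; rewrite mem_roots_in_closure.
exists (c + a), b0 => b /rb bE; rewrite -nubarC -horner_map roots_in_closureE.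
rewrite hornerZ horner_prod (eq_bigr (fun z => iota b - z)); last first.
  by move=> z _; rewrite !hornerE.
by rewrite polyCM Defs.valM bE nubarC lc /= addrA.
Qed.

Lemma slope_exists f : f != 0 -> exists2 s, (s <= (size f).-1)%N & slope v gam f s.
Proof. by move=> /slope_roots[s [s1 fs _]]; exists s. Qed.

Lemma slope_XsubC b : slope v gam ('X - b%:P) 0.
Proof.
have [c bc] := nomax b; exists (gam b), c => d /(lt_le_trans bc) bd.
rewrite !hornerE scalerBl.
have -> : d%:A - b%:A = (eta - b%:A) - (eta - d%:A) :> L.
  by rewrite opprB [RHS]addrC addrA subrK.
by rewrite valD_lt ?val_opp ?gamE ?ext_ltFin.
Qed.

Variables (p : nat) (g : {poly K}).
Hypotheses (pr_p : prime p) (gmonic : g \is monic) (sizeg : size g = p.+1).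
Hypothesis geta : (map_poly (in_alg L) g).[eta] = 0.
Hypothesis gmin : forall f, f != 0 -> (size f <= p)%N ->
  (map_poly (in_alg L) f).[eta] != 0.
Hypothesis slope_g : slope v gam g p.

Let nu := val_of_root v eta.

(** The value of [g] is [PInf] because [g] vanishes at [eta]. It is the sum of the values of the
    linear factors, so one of these is [PInf]. *)
Lemma epsilon_g : epsilon iota nubar g = PInf.
Proof.
have g0 := monic_neq0 gmonic.
suff [z gz zP] : exists2 z, root (map_poly iota g) z & nubar ('X - z%:P) = PInf.
  by apply/le_anti; rewrite ext_leP -zP le_epsilon.
have : nubar (\prod_(z <- roots_in_closure iota g) ('X - z%:P)) = PInf.
  have := roots_in_closureE iota g; rewrite (monicP gmonic) rmorph1 scale1r => <-.
  by rewrite hnubar -(Defs.val0 v) -geta.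
have : forall z, z \in roots_in_closure iota g -> root (map_poly iota g) z.
  by move=> z; rewrite mem_roots_in_closure.
elim: (roots_in_closure iota g) => [|z r IHr] rP; first by rewrite big_nil Defs.val1.
rewrite big_cons Defs.valM; have [zP|/val_Fin[a ->]] := eqVneq (nubar ('X - z%:P)) PInf.
  by move=> _; exists z => //; apply: rP; rewrite mem_head.
case E : (nubar _) => //= _; apply: IHr => // y yr.
by apply: rP; rewrite in_cons yr orbT.
Qed.

(** A root [z] with ['X - z%:P] of value [PInf] would give [f] the value [PInf], although [f] does
    not vanish at [eta]. *)
Lemma epsilon_lt_g f : f != 0 -> (size f <= p)%N -> epsilon iota nubar f < PInf.
Proof.
move=> f0 fp; have [f1|f1] := leqP (size f) 1.
  by rewrite epsilon_const //; apply/eqP; rewrite eqn_leq f1 size_poly_gt0.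
have [z fz ->] := epsilon_attained iota nubar f0 f1.
rewrite lt_neqAle ext_leP andbT; apply/eqP => zP.
have := hnubar f; have /factor_theorem[h ->] := fz.
rewrite Defs.valM zP; have [a ->] : exists a, nu f = Fin a.
  by apply: val_field_neq0; exact: gmin.
by have := val_neqNInf nubar h; case: (nubar h).
Qed.

(** A key polynomial [Q] of degree strictly between 1 and [p] has larger [epsilon] than every
    ['X - b%:P]. So a root attaining it is close and [Q] has positive slope, which [slope_prime]
    excludes. *)
Lemma limit_key_g : limit_key_polynomial nu iota nubar 1 g.
Proof.
split; [split|split].
- by exists ('X - 0%:P); apply/Psi1E; exists 0.
- move=> [Q /Psi1E[b ->] Qmax]; have [c bc] := nomax b.
  have /Qmax : Psi iota nubar 1 ('X - c%:P) by apply/Psi1E; exists c.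
  by rewrite /nu !val_of_root_XsubC leNgt ext_ltFin bc.
- split=> //; first by rewrite sizeg ltnS prime_gt0.
  by move=> f f0; rewrite sizeg ltnS epsilon_g; exact: epsilon_lt_g.
- by rewrite sizeg ltnS prime_gt1.
move=> Q [Qmonic Q1 Qkey] Q2; rewrite leqNgt sizeg ltnS; apply/negP => Qp.
have Q0 := monic_neq0 Qmonic; have [s [_ Qs s0]] := slope_roots Q0.
have [z Qz zE] := epsilon_attained iota nubar Q0 Q1.
have slope0 := slope_prime nomax slope_exists slope_XsubC pr_p sizeg slope_g Q0 Qp Qs.
have := s0 z Qz; rewrite slope0.
suff zc : close z by move=> /(_ zc).
move=> b; rewrite -zE -nubar_XsubC -epsilon_XsubC.
by apply: Qkey; rewrite ?polyXsubC_eq0 ?size_XsubC.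
Qed.

End LimitKey.

(** * Cuts and B(g) *)

Section Cuts.
Variables (G : orderedZmodType) (T : Type).
Hypothesis divG : forall (x : G) n, (0 < n)%N -> exists y, y *+ n = x.
Implicit Types u : T -> G.

Definition below u : set G := [set x | exists b, x <= u b].

Lemma cut_aboveE (A : Type) (B : set A) (F : A -> ext G) u :
  (forall x, (exists2 y, B y & Fin x <= F y) <-> exists b, x <= u b) ->
  cut_above [set F y | y in B] = below u.
Proof.
move=> E; apply/seteqP; split=> x.
  by move=> [_ [y By <-] xy]; apply/E; exists y.
by move=> /E[y By xy]; exists (F y) => //; exists y.
Qed.

(** A subgroup is stable under multiplication by [p], so the cut below it is stable under division
    by [p]. Conversely, this stability makes the elements lying above all [u b] and below all
    [- u b] a group. *)
Lemma below_subgroup_cut u p : (1 < p)%N -> T ->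
  (forall b, u b < 0) -> (forall b, exists c, u b < u c) ->
  (exists2 H, convex_subgroup H & below u = subgroup_cut H) <->
  (forall b, exists c, u b <= u c *+ p).
Proof.
move=> p1 t u0 umax; split.
  move=> [H [H0 HB _] uH] b.
  have Hmul h n : H h -> H (h *+ n).
    move=> Hh; have HN : H (- h) by rewrite -sub0r; exact: HB.
    by elim: n => [|n IHn] //; rewrite mulrSr -[X in _ + X]opprK; exact: HB.
  have [x xb] := divG (u b) (ltnW p1).
  suff : below u x by move=> [c xc]; exists c; rewrite -xb ozmod_leMn // ltnW.
  rewrite uH => _ [h Hh <-]; rewrite ext_ltFin -(@ozmod_ltMn G p) ?(ltnW p1) // xb.
  have : subgroup_cut H (u b) by rewrite -uH; exists b.
  by move=> /(_ (Fin (h *+ p))) /[!ext_ltFin]; apply; exists (h *+ p) => //; exact: Hmul.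
move=> uP; pose H : set G := [set h | forall b, u b < h /\ h < - u b].
have oppH h : H h -> H (- h).
  by move=> Hh b; have [? ?] := Hh b; rewrite -[X in X < _]opprK !ozmod_ltN.
have H0 : H 0 by move=> b; rewrite -[X in X < - _]oppr0 ozmod_ltN u0.
have lt_add (h h' x : G) : h < x -> h' < x -> h + h' < x *+ 2.
  by move=> hx h'x; apply: (@lt_trans _ _ (x + h')); rewrite ?ozmod_ltDr // ozmod_ltDl.
(* Closure under addition needs the factor 2; since [u c] is negative, [u c *+ p] is at most
   [u c *+ 2]. *)
have uP2 b : exists c, u b <= u c *+ 2.
  have [c bc] := uP b; exists c; apply: le_trans bc _.
  rewrite -(subnKC p1) mulrnDr -[X in _ <= X]addr0 ozmod_leDl -(mul0rn G (p - 2)).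
  by case: (p - 2)%N => // n; rewrite ozmod_leMn // ltW.
have addH h h' : H h -> H h' -> H (h + h').
  have half a a' b : H a -> H a' -> a + a' < - u b.
    move=> Ha Ha'; have [c bc] := uP2 b.
    apply: (@lt_le_trans _ _ ((- u c) *+ 2)).
      by apply: lt_add; [have [] := Ha c | have [] := Ha' c].
    by rewrite mulNrn ozmod_leN.
  move=> Hh Hh' b; split; last exact: half.
  by rewrite -ozmod_ltN opprD; apply: half; exact: oppH.
exists H.
  split=> // [x y Hx Hy|x y z Hx Hz xy yz b]; first by apply: addH => //; exact: oppH.
  have [bx _] := Hx b; have [_ zb] := Hz b.
  by rewrite (lt_le_trans bx xy) (le_lt_trans yz zb).
apply/seteqP; split=> [x [b xb] _ [h Hh <-]|x xH].
  by rewrite ext_ltFin; apply: le_lt_trans xb _; have [] := Hh b.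
(* An [x] below [H] but above all [u b] is negative, hence itself in [H], and so below itself. *)
apply: contrapT => /forallNP xu.
have ux b : u b < x by rewrite ozmod_ltNge; exact/negP.
have x0 : x < 0 by rewrite -ext_ltFin; apply: xH; exists 0.
have Hx : H x.
  move=> b; split=> //; apply: lt_trans x0 _.
  by rewrite -[X in X < _]oppr0 ozmod_ltN.
by have := xH (Fin x); rewrite ltxx => /(_ (ex_intro2 _ _ x Hx erefl)).
Qed.

Lemma cut_shift_below u d : cut_shift d (below (fun b => u b - d)) = below u.
Proof.
apply/seteqP; split=> [_ [x [b xb] <-]|x [b xb]].
  by exists b; rewrite -(ozmod_leDl (- d)) addKr addrC.
by exists (x - d); [exists b; rewrite ozmod_leDr | rewrite addrC subrK].
Qed.

Lemma cut_shift_inj (d : G) : injective (cut_shift d).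
Proof.
have sub A B : cut_shift d A = cut_shift d B -> A `<=` B.
  move=> AB x Ax; have : cut_shift d A (d + x) by exists x.
  by rewrite AB => -[y By /addrI <-].
by move=> A B AB; apply/seteqP; split; exact: sub.
Qed.

End Cuts.

Section Expansion.
Variable K : fieldType.

Lemma expansion_coef_comp (b : K) (h : {poly K}) i :
  expansion_coef ('X - b%:P) (h \Po ('X - b%:P)) i = (h`_i)%:P.
Proof.
rewrite /expansion_coef; elim/poly_ind: h i => [|h c IHh] i.
  by rewrite comp_poly0 div0p mod0p coef0.
set Q := 'X - b%:P.
have Q0 : Q != 0 by rewrite polyXsubC_eq0.
have sc : (size c%:P < size Q)%N by rewrite size_XsubC ltnS size_polyC_leq1.
have -> : (h * 'X + c%:P) \Po Q = (h \Po Q) * Q + c%:P.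
  by rewrite comp_polyD comp_polyM comp_polyX comp_polyC.
case: i => [|i].
  rewrite expr0 divp1 modp_addl_mul_small //.
  by rewrite coefD coefMX coefC eqxx add0r.
by rewrite exprS -divp_divl divp_addl_mul_small // IHh coefD coefMX coefC addr0.
Qed.

Lemma expansion_coef_XsubC (b : K) (f : {poly K}) i :
  expansion_coef ('X - b%:P) f i = ((f \Po ('X + b%:P))`_i)%:P.
Proof.
rewrite -(expansion_coef_comp b) -comp_polyA comp_polyD comp_polyX comp_polyC.
by rewrite subrK comp_polyXr.
Qed.

Lemma truncation_le (G : orderedZmodType) (nu : valuation {poly K} G) (Q f : {poly K}) i :
  (i < size f)%N -> truncation nu Q f <= nu (expansion_coef Q f i * Q ^+ i).
Proof.
move=> fi; have [->|c0] := eqVneq (expansion_coef Q f i) 0.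
  by rewrite mul0r Defs.val0 ext_leP.
by rewrite /truncation (bigD1 (Ordinal fi)) //= ge_min lexx.
Qed.

Lemma le_truncation (G : orderedZmodType) (nu : valuation {poly K} G) (Q f : {poly K}) x :
  (forall i, (i < size f)%N -> x <= nu (expansion_coef Q f i * Q ^+ i)) ->
  x <= truncation nu Q f.
Proof.
move=> xP; rewrite /truncation; elim/big_ind: _ => [|y z xy xz|i _].
- exact: ext_leP.
- by rewrite le_min xy.
exact: xP.
Qed.

End Expansion.

Section Bset.
Variables (K : fieldType) (L : fieldExtType K) (G : orderedZmodType).
Variables (v : valuation L G) (eta : L) (gam : K -> G).
Variables (Kbar : closedFieldType) (iota : {rmorphism K -> Kbar}).
Variable nubar : valuation {poly Kbar} G.
Hypothesis gamE : forall b, v (eta - b%:A) = Fin (gam b).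
Hypothesis nomax : forall b, exists c, gam b < gam c.
Variables (p : nat) (g : {poly K}) (d : G) (b0 : K).
Hypotheses (p_gt1 : (1 < p)%N) (gmonic : g \is monic) (sizeg : size g = p.+1).

(** This is the value at [b] of the i-th Hasse derivative of [g], the coefficient in the expansion
    at ['X - b%:P]. *)
Definition taylor_coef b i := (g \Po ('X + b%:P))`_i.

Let nu := val_of_root v eta.

Hypothesis gam_lt : forall b, gam b < d.
Hypothesis val_g : forall b, v (g.[b])%:A = Fin (gam b *+ p).
Hypothesis coef1 : forall b, gam b0 <= gam b -> v (taylor_coef b 1)%:A = Fin (d *+ p.-1).
Hypothesis coef_ge : forall b i, gam b0 <= gam b -> (0 < i < p)%N ->
  Fin (d *+ p.-1 + gam b) <= ext_add (v (taylor_coef b i)%:A) (Fin (gam b *+ i)).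

Lemma expansion_term b i :
  nu (expansion_coef ('X - b%:P) g i * ('X - b%:P) ^+ i) =
  ext_add (v (taylor_coef b i)%:A) (Fin (gam b *+ i)).
Proof.
rewrite expansion_coef_XsubC Defs.valM (valX i (val_of_root_XsubC gamE b)).
by rewrite /= horner_algC.
Qed.

Lemma expansion_term0 b :
  nu (expansion_coef ('X - b%:P) g 0 * ('X - b%:P) ^+ 0) = Fin (gam b *+ p).
Proof.
rewrite expansion_term /taylor_coef -horner_coef0 horner_comp !hornerE val_g /=.
by rewrite mulr0n addr0.
Qed.

Lemma expansion_term_top b :
  nu (expansion_coef ('X - b%:P) g p * ('X - b%:P) ^+ p) = Fin (gam b *+ p).
Proof.
rewrite expansion_term.
have -> : taylor_coef b p = lead_coef (g \Po ('X + b%:P)).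
  by rewrite /taylor_coef lead_coefE size_comp_poly2 ?size_XaddC // sizeg.
rewrite lead_coef_comp ?size_XaddC // (monicP gmonic) lead_coefXaddC.
by rewrite expr1n mul1r scale1r Defs.val1 ext_add0.
Qed.

(** The constant term bounds the minimum by [gam b *+ p]. Beyond [b0] no term has smaller value,
    because [gam b < d] gives [gam b *+ p <= d *+ p.-1 + gam b]. *)
Lemma delta_belowE : delta nu iota nubar 1 g = below (fun b => gam b *+ p).
Proof.
apply: cut_aboveE => x; split.
  move=> [Q /Psi1E[b ->] xQ]; exists b; rewrite -ext_leFin -expansion_term0.
  by apply: le_trans xQ _; apply: truncation_le; rewrite sizeg.
move=> [b xb]; have [c [bc b0c]] := gam_max gam b b0.
exists ('X - c%:P); first by apply/Psi1E; exists c.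
have p0 := ltnW p_gt1.
have xc : Fin x <= Fin (gam c *+ p) by apply: le_trans xb _; rewrite ozmod_leMn.
apply: le_truncation => i; rewrite sizeg ltnS leq_eqVlt => /orP[/eqP ->|ip].
  by rewrite expansion_term_top.
have [->|i0] := posnP i; first by rewrite expansion_term0.
rewrite expansion_term; apply: le_trans xc (le_trans _ (coef_ge b0c _)); last by rewrite i0.
rewrite ext_leFin -[X in _ *+ X <= _](prednK p0) mulrSr ozmod_leDr.
by rewrite ozmod_leMn ?ltW // -subn1 subn_gt0.
Qed.

(** The element [d *+ p] shows strictness: it exceeds every [gam b *+ p]. *)
Lemma delta_lt : delta nu iota nubar 1 g `<` cut_below [set PInf].
Proof.
rewrite delta_belowE; split=> [x _ _ -> //|/(_ (d *+ p))].
have dP : cut_below [set PInf] (d *+ p) by move=> _ ->.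
by move=> /(_ dP)[b]; rewrite ozmod_leMn 1?ltnW // ozmod_leNgt gam_lt.
Qed.

(** Beyond [b0] no intermediate term has smaller value than the linear one, so the set is nonempty
    only if 1 belongs to it. Membership of 1 compares [d *+ p.-1 + gam b] with some [gam c *+ p];
    subtracting [d *+ p] gives the stated form. *)
Lemma Bset_eq0 : Bset nu iota nubar 1 g p = set0 <->
  ~ (forall b, exists c, gam b - d <= (gam c - d) *+ p).
Proof.
have p0 := ltnW p_gt1.
have shiftE b c : (gam b - d <= (gam c - d) *+ p) = (d *+ p.-1 + gam b <= gam c *+ p).
  rewrite -(ozmod_leDr (d *+ p)) mulrnBl subrK; congr (_ <= _).
  by rewrite -[in LHS](prednK p0) mulrS addrA subrK addrC.
split=> [B0 gP|gP].
  suff : Bset nu iota nubar 1 g p 1 by rewrite B0.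
  split; first by rewrite p_gt1.
  exists ('X - b0%:P); first by apply/Psi1E; exists b0.
  move=> Q /Psi1E[b ->]; rewrite /nu !(val_of_root_XsubC gamE) => b0b.
  exists (d *+ p.-1 + gam b); last by rewrite expansion_term coef1.
  by rewrite delta_belowE; have [c bc] := gP b; exists c; rewrite -shiftE.
apply/seteqP; split=> // i [ip [Q1 /Psi1E[b1 ->] BP]]; apply: gP => b.
have [c1 [bc1 b0c1]] := gam_max gam b b0; have [c [c1c b1c]] := gam_max gam c1 b1.
have Psic : Psi iota nubar 1 ('X - c%:P) by apply/Psi1E; exists c.
have [|x] := BP _ Psic; first by rewrite /nu !(val_of_root_XsubC gamE).
rewrite delta_belowE => -[e xe]; rewrite expansion_term => cx.
have := coef_ge (le_trans b0c1 c1c) ip; rewrite cx ext_leFin => cx'.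
exists e; rewrite shiftE; apply: le_trans (le_trans _ cx') xe.
by rewrite ozmod_leDl (le_trans bc1).
Qed.

End Bset.

(** * The Artin-Schreier and Kummer cases *)

Section DefectExtension.
Variables (K : fieldType) (L : fieldExtType K) (G : orderedZmodType).
Variables (v : valuation L G) (p : nat) (eta : L) (g : {poly K}).
Hypotheses (pr_p : prime p) (sizeg : size g = p.+1).
Hypothesis hL : <<1; eta>>%VS = fullv.
Hypothesis hg : minPoly 1%AS eta = map_poly (in_alg L) g.
Hypothesis hd : has_defect v (in_alg L) p.

Lemma generator_monic : g \is monic.
Proof. by rewrite -(map_monic (in_alg L)) -hg monic_minPoly. Qed.

Lemma generator_root : root (map_poly (in_alg L) g) eta.
Proof. by rewrite -hg root_minPoly. Qed.

Lemma generator_gen l : exists q : {poly K}, l = (map_poly (in_alg L) q).[eta].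
Proof.
have : l \in <<1; eta>>%VS by rewrite hL memvf.
by move=> /Fadjoin_polyP[q /polyOver1P[r ->] ->]; exists r.
Qed.

Lemma generator_min (f : {poly K}) : f != 0 -> (size f <= p)%N ->
  (map_poly (in_alg L) f).[eta] != 0.
Proof.
move=> f0; rewrite -ltnS -sizeg ltnNge; apply: contra => /eqP/rootP feta.
have fK : map_poly (in_alg L) f \is a polyOver 1%AS by apply/polyOver1P; exists f.
have := dvdp_leq _ (minPoly_dvdp fK feta); rewrite hg !size_map_poly; apply.
by rewrite map_poly_eq0.
Qed.

(** Equality of value groups provides [c] with the value of [eta - b], and equality of residue
    fields an [e] approximating the quotient; then [b + c * e] is closer to [eta] than [b]. *)
Lemma approximation_values : exists gam : K -> G,
  [/\ forall b, v (eta - b%:A) = Fin (gam b), forall b, exists c, gam b < gam c &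
      forall eta', root (map_poly (in_alg L) g) eta' ->
        forall b, Fin (gam b) < v (eta' - eta)].
Proof.
have p2 := prime_gt1 pr_p.
have [vK rK unib] := has_defect_unibranched (ltnW p2) hd generator_monic sizeg
  generator_root generator_gen.
have hornerB b x : (map_poly (in_alg L) ('X - b%:P)).[x] = x - b%:A.
  by rewrite rmorphB /= map_polyX map_polyC !hornerE.
have /choice[gam gamE] b : exists x, v (eta - b%:A) = Fin x.
  apply: val_field_neq0; rewrite -hornerB generator_min ?polyXsubC_eq0 //.
  by rewrite size_XsubC.
have nomax b : exists c, gam b < gam c.
  have [c cb] := vK _ _ (gamE b).
  have c0 : c%:A != 0 :> L by apply: contra_eq_neq cb => ->; rewrite Defs.val0.
  have [|e e0] := rK ((eta - b%:A) / c%:A).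
    by rewrite Defs.valM gamE (val_fieldV cb) /= subrr.
  exists (b + c * e); rewrite -ext_ltFin -(gamE (b + c * e)).
  have -> : eta - (b + c * e)%:A = c%:A * ((eta - b%:A) / c%:A - e%:A).
    rewrite mulrBr [c%:A * _]mulrC divfK //.
    by rewrite -[c%:A * _](rmorphM (in_alg L)) /= scalerDl opprD addrA.
  rewrite Defs.valM cb; move: e0; case: (v _) => //= x x0.
  by rewrite ext_ltFin -[X in X < _]addr0 ozmod_ltDl -ext_ltFin.
exists gam; split=> // eta' geta' b.
(* Both [eta' - c] and [eta - c] have value at least [gam c], hence so has their difference; the
   detour through [c] makes the bound at [b] strict. *)
have [c bc] := nomax b; apply: lt_le_trans (_ : Fin (gam c) <= _).
  by rewrite ext_ltFin.
rewrite -[eta'](subrK c%:A) -addrA; apply: valD_le; last first.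
  by rewrite -opprB val_opp gamE.
have [e ec] := vK _ _ (gamE c).
have e0 : e%:A != 0 :> L by apply: contra_eq_neq ec => ->; rewrite Defs.val0.
(* [unib] compares integrality only, so the linear polynomial is divided by an [e] of value
   [gam c]. *)
pose q := e^-1 *: ('X - c%:P).
have qE x : (map_poly (in_alg L) q).[x] = (e%:A)^-1 * (x - c%:A).
  by rewrite /q linearZ /= hornerZ hornerB; congr (_ * _); exact: (fmorphV (in_alg L)).
have := unib _ geta' q; rewrite !qE [X in _ = (_ <= X)]Defs.valM gamE (val_fieldV ec) /=.
rewrite addNr lexx Defs.valM (val_fieldV ec); case: (v _) => //= x.
by rewrite !ext_leFin -(ozmod_leDl (gam c) 0) addr0 addrA subrr add0r.
Qed.

Variables (Kbar : closedFieldType) (iota : {rmorphism K -> Kbar}).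
Variable nubar : valuation {poly Kbar} G.
Hypothesis hnubar : is_poly_extension (val_of_root v eta) iota nubar.
Variables (gam : K -> G) (d : G) (b0 : K).
Hypothesis gamE : forall b, v (eta - b%:A) = Fin (gam b).
Hypothesis nomax : forall b, exists c, gam b < gam c.
Hypothesis gam_lt : forall b, gam b < d.
Hypothesis val_g : forall b, v (g.[b])%:A = Fin (gam b *+ p).
Hypothesis coef1 : forall b, gam b0 <= gam b ->
  v (taylor_coef g b 1)%:A = Fin (d *+ p.-1).
Hypothesis coef_ge : forall b i, gam b0 <= gam b -> (0 < i < p)%N ->
  Fin (d *+ p.-1 + gam b) <= ext_add (v (taylor_coef g b i)%:A) (Fin (gam b *+ i)).

Lemma dist_below : dist v eta = below gam.
Proof.
apply: cut_aboveE => x; split=> [[b _]|[b xb]]; first by rewrite gamE => xb; exists b.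
by exists b; rewrite ?gamE.
Qed.

Lemma limit_key_delta_Bset : let nu := val_of_root v eta in
  [/\ limit_key_polynomial nu iota nubar 1 g,
      delta nu iota nubar 1 g `<` cut_below [set PInf] &
      Bset nu iota nubar 1 g p = set0 <->
        ~ (forall b, exists c, gam b - d <= (gam c - d) *+ p)].
Proof.
have p2 := prime_gt1 pr_p; split.
- apply: limit_key_g pr_p generator_monic sizeg _ generator_min _ => //.
    exact/rootP/generator_root.
  by exists 0, 0 => b _; rewrite add0r.
- exact: (delta_lt iota nubar gamE p2 generator_monic sizeg gam_lt val_g coef_ge).
exact: (Bset_eq0 iota nubar gamE p2 generator_monic sizeg gam_lt val_g coef1 coef_ge).
Qed.

End DefectExtension.

Section ArtinSchreier.
Variables (K : fieldType) (L : fieldExtType K) (G : orderedZmodType).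
Variables (v : valuation L G) (p : nat) (eta : L) (a : K) (gam : K -> G).
Hypotheses (pr_p : prime p) (pK : p \in [pchar K]).

Let g : {poly K} := 'X^p - 'X - a%:P.

Lemma size_artin_schreier : size g = p.+1.
Proof.
rewrite /g -addrA size_polyDl ?size_polyXn // -opprD size_polyN.
by rewrite size_XaddC ltnS prime_gt1.
Qed.

Hypothesis geta : root (map_poly (in_alg L) g) eta.
Hypothesis gamE : forall b, v (eta - b%:A) = Fin (gam b).
Hypothesis conj : forall eta', root (map_poly (in_alg L) g) eta' ->
  forall b, Fin (gam b) < v (eta' - eta).

Lemma artin_schreier_rootE x :
  root (map_poly (in_alg L) g) x = (x ^+ p - x == a%:A).
Proof.
by rewrite /root /g !rmorphB /= map_polyXn map_polyX map_polyC !hornerE subr_eq0.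
Qed.

Lemma pchar_extension : p \in [pchar L].
Proof. by rewrite (fmorph_pchar (in_alg L)). Qed.

(** [eta + 1] is another root of [g], and it differs from [eta] by an element of value 0. *)
Lemma artin_schreier_gam_lt b : gam b < 0.
Proof.
rewrite -ext_ltFin -(Defs.val1 v) -[X in v X](addrK eta) [1 + eta]addrC; apply: conj.
move: geta; rewrite !artin_schreier_rootE => /eqP <-.
rewrite -!(pFrobenius_autE pchar_extension) rmorphD rmorph1 /=.
by rewrite opprD addrACA subrr addr0.
Qed.

(** By additivity of Frobenius, [g] at [b] is [(b - eta) ^+ p - (b - eta)]; as [gam b] is negative,
    the power dominates. *)
Lemma artin_schreier_val b : v (g.[b])%:A = Fin (gam b *+ p).
Proof.
have gb : (g.[b])%:A = (b%:A - eta) ^+ p - (b%:A - eta) :> L.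
  rewrite -(pFrobenius_autE pchar_extension) rmorphB /= !(pFrobenius_autE pchar_extension).
  move: geta; rewrite artin_schreier_rootE => /eqP etaE.
  rewrite /g !hornerE -[LHS]/(in_alg L _) !rmorphB rmorphXn /= -etaE; ring.
have vb : v (b%:A - eta) = Fin (gam b) by rewrite val_subC.
rewrite gb valD_lt (valX _ vb) // val_opp vb ext_ltFin.
rewrite -[in X in X < _](prednK (prime_gt0 pr_p)) mulrS -[X in _ < X]addr0 ozmod_ltDl.
have p1 : (0 < p.-1)%N by rewrite -subn1 subn_gt0 prime_gt1.
by rewrite -(mul0rn G p.-1) ozmod_ltMn ?artin_schreier_gam_lt.
Qed.

Lemma artin_schreier_coef b i : (0 < i < p)%N ->
  taylor_coef g b i = if i == 1%N then -1 else 0.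
Proof.
case/andP=> i0 ip; rewrite /taylor_coef /g !comp_polyB comp_Xn_poly comp_polyX comp_polyC.
have pP : p \in [pchar {poly K}] by rewrite pchar_poly.
rewrite -(pFrobenius_autE pP) rmorphD /= !(pFrobenius_autE pP) -polyC_exp.
rewrite !coefB !coefD coefXn coefX !coefC (gtn_eqF i0) (ltn_eqF ip) !addr0 subr0 sub0r.
by case: eqP => // _; rewrite oppr0.
Qed.

End ArtinSchreier.

Section Kummer.
Variables (K : fieldType) (L : fieldExtType K) (G : orderedZmodType).
Variables (v : valuation L G) (p : nat) (eta : L) (a z : K) (gam : K -> G).
Hypotheses (pr_p : prime p) (prim_z : p.-primitive_root z).

Let g : {poly K} := 'X^p - a%:P.

Hypothesis geta : root (map_poly (in_alg L) g) eta.
Hypothesis va : v a%:A = Fin 0.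
Hypothesis gamE : forall b, v (eta - b%:A) = Fin (gam b).
Hypothesis nomax : forall b, exists c, gam b < gam c.
Hypothesis conj : forall eta', root (map_poly (in_alg L) g) eta' ->
  forall b, Fin (gam b) < v (eta' - eta).

Lemma kummer_rootE x : root (map_poly (in_alg L) g) x = (x ^+ p == a%:A).
Proof.
by rewrite /root /g rmorphB /= map_polyXn map_polyC !hornerE subr_eq0.
Qed.

Let zL : L := z%:A.
Let prim_zL : p.-primitive_root zL.
Proof. by rewrite /zL -[z%:A]/(in_alg L z) fmorph_primitive_root. Qed.

Lemma kummer_eta : v eta = Fin 0.
Proof.
have p0 := prime_gt0 pr_p.
move: geta; rewrite kummer_rootE => /eqP etaE.
have [x xE] : exists x, v eta = Fin x.
  apply: val_field_neq0; apply: contra_eq_neq va => eta0.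
  by rewrite -etaE eta0 expr0n gtn_eqF // Defs.val0.
move: va; rewrite -etaE (valX _ xE) => -[]; rewrite -(mul0rn G p) => /(ozmod_mulrn_inj p0) xx.
by rewrite xE xx mul0rn.
Qed.

Lemma kummer_eta_neq0 : eta != 0.
Proof. by apply: contra_eq_neq kummer_eta => ->; rewrite Defs.val0. Qed.

Lemma kummer_conj i b : Fin (gam b) < v (zL ^+ i * eta - eta).
Proof.
apply: conj; move: geta; rewrite !kummer_rootE exprMn -exprM mulnC exprM.
by rewrite (prim_expr_order prim_zL) expr1n mul1r.
Qed.

(** [g] at [b] is the product of the [b - zL ^+ i * eta]. Each factor has value [gam b], since the
    conjugates are closer to [eta] than [b] is. *)
Lemma kummer_val b : v (g.[b])%:A = Fin (gam b *+ p).
Proof.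
have gb : (g.[b])%:A = \prod_(0 <= i < p) (b%:A - zL ^+ i * eta) :> L.
  move: geta; rewrite kummer_rootE => /eqP etaE.
  have eta0 := kummer_eta_neq0.
  have := congr1 (horner^~ (b%:A / eta)) (factor_Xn_sub_1 prim_zL).
  rewrite /= horner_prod !hornerE => E.
  rewrite -[LHS]/(in_alg L _) rmorphB rmorphXn /= -etaE.
  have -> : b%:A ^+ p - eta ^+ p = ((b%:A / eta) ^+ p - 1) * eta ^+ p.
    by rewrite mulrBl mul1r -exprMn divfK.
  rewrite -E -[X in eta ^+ X](subn0 p) -prodr_const_nat -big_split /=.
  apply: eq_bigr => i _; by rewrite !hornerE mulrBl divfK.
have valF i : v (b%:A - zL ^+ i * eta) = Fin (gam b).
  rewrite val_subC -[zL ^+ i * eta](subrK eta) -addrA addrC valD_lt gamE //.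
  exact: kummer_conj.
rewrite gb -[X in _ *+ X](subn0 p) -(size_iota 0 (p - 0)) /index_iota.
elim: (iota _ _) => [|i r IHr]; first by rewrite big_nil Defs.val1.
by rewrite big_cons Defs.valM IHr valF /= mulrS.
Qed.

(** Cancelling ['X - 1] in ['X^p - 1] leaves the sum of the powers of ['X] below [p], evaluated at
    1. *)
Lemma prod_one_sub_root : \prod_(1 <= i < p) (1 - zL ^+ i) = p%:R.
Proof.
have p0 := prime_gt0 pr_p.
have := factor_Xn_sub_1 prim_zL; rewrite big_ltn // expr0 subrX1.
move=> /(mulfI (negbT (polyXsubC_eq0 1))) /(congr1 (horner^~ 1)).
rewrite horner_prod horner_sum => E.
rewrite (eq_bigr (fun i => ('X - (zL ^+ i)%:P).[1])) => [|i _]; last by rewrite !hornerE.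
rewrite E (eq_bigr (fun=> 1)) ?sumr_const ?card_ord // => i _.
by rewrite hornerXn expr1n.
Qed.

(** As [eta] has value 0, each of the [p.-1] factors [1 - zL ^+ i] of [p] has value at least
    [gam c]. This yields [gam c <= d], and [nomax] makes it strict. *)
Lemma kummer_gam_le d b : v p%:R = Fin (d *+ p.-1) -> gam b < d.
Proof.
move=> pd; have p2 := prime_gt1 pr_p.
have p1 : (0 < p.-1)%N by rewrite -subn1 subn_gt0.
suff le c : gam c <= d by have [c bc] := nomax b; exact: lt_le_trans bc (le c).
rewrite -(@ozmod_leMn G p.-1) // -ext_leFin -pd -prod_one_sub_root -subn1.
rewrite -(size_iota 1 (p - 1)).
have oneF i : Fin (gam c) <= v (1 - zL ^+ i).
  have := ltW (kummer_conj i c); rewrite -{2}[eta]mul1r -mulrBl Defs.valM kummer_eta.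
  by rewrite ext_addC ext_add0 val_subC.
rewrite /index_iota; elim: (iota _ _) => [|i r IHr]; first by rewrite big_nil Defs.val1.
rewrite big_cons Defs.valM /= mulrS; move: IHr (oneF i).
case: (v _) => //= [x|]; case: (v _) => //= y xc yc.
by rewrite ext_leFin ozmod_leD.
Qed.

Lemma kummer_coef b i : (0 < i)%N -> (i <= p)%N ->
  taylor_coef g b i = b ^+ (p - i) *+ 'C(p, i).
Proof.
move=> i0 ip; rewrite /taylor_coef /g comp_polyB comp_Xn_poly comp_polyC.
rewrite ['X + _]addrC exprDn coefB coefC (gtn_eqF i0) subr0 coef_sum.
rewrite (bigD1 (Ordinal (ip : (i < p.+1)%N))) //= big1 ?addr0 => [|j ji].
  by rewrite coefMn -polyC_exp coefCM coefXn eqxx mulr1.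
rewrite coefMn -polyC_exp coefCM coefXn [i == j]eq_sym.
by rewrite (_ : (j == i :> nat) = false) ?mulr0 ?mul0rn //; exact/negbTE.
Qed.

Lemma kummer_val_ge0 b : gam 0 < gam b -> v b%:A = Fin 0.
Proof.
move=> b0; have -> : b%:A = eta - (eta - b%:A) :> L by rewrite opprB addrC subrK.
rewrite valD_lt ?kummer_eta // val_opp gamE ext_ltFin.
suff -> : 0 = gam 0 by [].
by have := gamE 0; rewrite scale0r subr0 kummer_eta => -[].
Qed.

End Kummer.

Theorem proposition1p3 (K : fieldType) (L : fieldExtType K)
    (G : orderedZmodType) (v : valuation L G) (p : nat) (eta : L) (a : K)
    (g : {poly K}) (Kbar : closedFieldType) (iota : {rmorphism K -> Kbar})
    (nubar : valuation {poly Kbar} G)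
    (hG : is_divisible_closure (value_group v))
    (hp : p \in [pchar (residue_field (pullback v (in_alg L)))])
    (hL : <<1; eta>>%VS = fullv)
    (hg : minPoly 1%AS eta = map_poly (in_alg L) g)
    (hd : has_defect v (in_alg L) p)
    (hKbar : is_algebraic_closure iota)
    (hnubar : is_poly_extension (val_of_root v eta) iota nubar)
    (c : defect_case) (hc : case_assumption v p c g a) :
  let nu := val_of_root v eta in
  [/\ limit_key_polynomial nu iota nubar 1 g,
      delta nu iota nubar 1 g `<` cut_below [set PInf] &
      Bset nu iota nubar 1 g p = set0 <-> dependent v p eta c].
Proof.
have pr_p : prime p by case/andP: hp.
have [divG _] := hG.
have p2 := prime_gt1 pr_p.
have p1 : (0 < p.-1)%N by rewrite -subn1 subn_gt0.
have geta := generator_root hg.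
have sizeg : size g = p.+1.
  case: c hc => [[_ ->]|[_ -> _]]; first exact: size_artin_schreier.
  by rewrite size_XnsubC ?prime_gt0.
have [gam [gamE nomax conj]] := approximation_values pr_p sizeg hL hg hd.
have distE := dist_below gamE.
case: c hc => [[pK gE]|[[z prim_z] gE va]]; rewrite {}gE in hg sizeg geta conj *.
  have gam0 := artin_schreier_gam_lt pK geta conj.
  have coefP b i : (0 < i < p)%N ->
      v (taylor_coef ('X^p - 'X - a%:P) b i)%:A = if i == 1%N then Fin 0 else PInf.
    move=> ip; rewrite artin_schreier_coef //; case: eqP => _.
      by rewrite scaleN1r val_opp Defs.val1.
    by rewrite scale0r Defs.val0.
  (* With [d = 0] the bounds hold for every [b], so any [b0] serves; the coefficients strictly
     between the linear and the top one vanish and have value [PInf]. *)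
  have [||lim del Bs] := limit_key_delta_Bset pr_p sizeg hg hnubar gamE nomax gam0
    (artin_schreier_val pr_p pK geta gamE conj) (b0 := 0).
  - by move=> b _; rewrite coefP ?p2 //= mul0rn.
  - move=> b i _ ip; rewrite coefP // mul0rn add0r.
    by case: eqP => [->|_]; rewrite ?ext_leP //= add0r.
  split=> //; rewrite Bs /dependent /= distE (below_subgroup_cut divG p2 0 gam0 nomax).
  by split=> gP E; apply: gP => b; have [e be] := E b; exists e; move: be; rewrite !subr0.
(* The value of [p] is finite: [p] is the product of the [1 - z ^+ i], nonzero by primitivity of
   [z]. *)
have vp : exists x, v p%:R = Fin x.
  apply: val_field_neq0; rewrite -(prod_one_sub_root L pr_p prim_z).
  rewrite prodf_seq_neq0; apply/allP => i; rewrite mem_index_iota => /andP[i0 ip] /=.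
  rewrite subr_eq0 eq_sym -[z%:A]/(in_alg L z) -rmorphXn fmorph_eq1.
  by rewrite -(prim_order_dvd prim_z) gtnNdvd.
have [y yp] := vp; have [d dE] := divG y _ p1.
have {y dE vp}yp : v p%:R = Fin (d *+ p.-1) by rewrite dE.
have gamd b := kummer_gam_le pr_p prim_z geta va nomax conj b yp.
(* Every [b] at least as close to [eta] as [b0] is closer than 0 and so has value 0; in [coefE] only
   the binomial coefficient then counts. *)
have [b0 b00] := nomax 0.
have vb b : gam b0 <= gam b -> v b%:A = Fin 0.
  by move=> b0b; apply: (kummer_val_ge0 pr_p geta va gamE); apply: lt_le_trans b0b.
have gam0 : gam 0 = 0.
  by have := gamE 0; rewrite scale0r subr0 (kummer_eta pr_p geta va) => -[].
have coefE b i : (0 < i < p)%N -> gam b0 <= gam b ->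
    v (taylor_coef ('X^p - a%:P) b i)%:A = v ('C(p, i))%:R.
  move=> /andP[i0 ip] b0b; rewrite kummer_coef //; last exact: ltnW.
  have -> : (b ^+ (p - i) *+ 'C(p, i))%:A = b%:A ^+ (p - i) * 'C(p, i)%:R :> L.
    have := rmorphXn (in_alg L) (p - i) b; rewrite /= => <-.
    by rewrite mulr_natr scalerMnl.
  by rewrite Defs.valM (valX _ (vb b b0b)) mul0rn ext_add0.
have [||lim del Bs] := limit_key_delta_Bset pr_p sizeg hg hnubar gamE nomax gamd
  (kummer_val pr_p prim_z geta va gamE conj) (b0 := b0).
- by move=> b b0b; rewrite coefE ?p2 // bin1.
- move=> b i b0b ip; rewrite coefE //.
  (* An intermediate binomial coefficient is a multiple of [p], so its value is at least
     [d *+ p.-1]; as [gam b] is positive, [gam b *+ i] is at least [gam b]. *)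
  have /dvdnP[m ->] := prime_dvd_bin pr_p ip.
  rewrite natrM Defs.valM yp; have := val_nat_ge0 v m.
  have ib : gam b <= gam b *+ i.
    have i0 : (0 < i)%N by case/andP: ip.
    rewrite -[X in _ *+ X](prednK i0) mulrS -[X in X <= _]addr0 ozmod_leDl.
    have [->|i1] := posnP i.-1; first by rewrite mulr0n.
    by rewrite -(mul0rn G i.-1) ozmod_leMn // -gam0 ltW // (lt_le_trans b00).
  case: (v _) => //= x x0; rewrite ext_leFin ozmod_leD //.
  by rewrite -[X in X <= _]add0r ozmod_leDr.
split=> //; rewrite Bs /dependent /= distE.
have uneg b : gam b - d < 0 by rewrite ozmod_subr_lt0.
have umax b : exists c, gam b - d < gam c - d.
  by have [c bc] := nomax b; exists c; rewrite ozmod_ltDr.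
(* Torsion freeness identifies [d'] with [d], and shifting back by [d] leads to the negative family
   [gam b - d]. *)
have -> : (exists H d', [/\ convex_subgroup H, v p%:R = Fin (d' *+ p.-1) &
      below gam = cut_shift d' (subgroup_cut H)]) <->
    (exists2 H, convex_subgroup H & below (fun b => gam b - d) = subgroup_cut H).
  split=> [[H [d' [Hc pd' HE]]]|[H Hc HE]]; exists H => //.
    move: pd'; rewrite yp => -[/(ozmod_mulrn_inj p1) dd'].
    by apply: (@cut_shift_inj _ d); rewrite cut_shift_below HE dd'.
  by exists d; split=> //; rewrite -HE cut_shift_below.
by rewrite (below_subgroup_cut divG p2 0 uneg umax).
Qed.
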